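(* Let $A\in\mathcal D$ and let $(P,Q)\in\mathcal D_A$, with generic parts $P_0=P|_{\mathcal H_0}$ and $Q_0=Q|_{\mathcal H_0}$. Then $c(R(P),R(Q))=\|P_0Q_0\|$. Using the Halmos representation of $(P_0,Q_0)$, $$\|P_0Q_0\|=\|P_0Q_0P_0\|^{1/2}=\left\|\begin{pmatrix} C^2 & 0 \\ 0 & 0 \end{pmatrix}\right\|^{1/2}=\|C\|.$$ Then the Friedrichs angle between $R(P)$ and $R(Q)$ equals $\cos^{-1}(\|\cos(\Gamma)\|)$. If $\Gamma$ is non invertible, then $0\in\sigma(\Gamma)$ and therefore $1\in\sigma(C)$, and thus the angle is $\pi/2$. If $\Gamma$ is invertible (which is equivalent to $A^2-1$ being of closed range), then $\|\cos(\Gamma)\|=\cos(\|\Gamma^{-1}\|^{-1})$, and the angle is $\|\Gamma^{-1}\|^{-1}$, or, equivalently, the lowest value in the spectrum of $\Gamma$. In any case, this quantity is an invariant of $A$ (it is the same for all pairs in $\mathcal D_A$). Also $\|P_0+Q_0\|$ is an invariant of $A_0$ (it is the same for all pairs in $\mathcal D_{A_0}$).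
   Context: Let $\mathcal H$ be a Hilbert space, $\mathcal P(\mathcal H)$ the set of orthogonal projections in $\mathcal H$, $\mathcal D=\{P-Q: P,Q\in\mathcal P(\mathcal H)\}$, and for $A\in\mathcal D$ let $\mathcal D_A=\{(P,Q)\in\mathcal P(\mathcal H)\times\mathcal P(\mathcal H): P-Q=A\}$. $R(T)$, $N(T)$ and $\sigma(T)$ denote range, nullspace and spectrum. The subspace $\mathcal H_0=(N(A)\oplus N(A^2-1))^\perp$ reduces $A$, and reduces $P$ and $Q$ for every $(P,Q)\in\mathcal D_A$; $A_0=A|_{\mathcal H_0}$ is the generic part of $A$, and $\mathcal D_{A_0}$ is the set of pairs $(P_0,Q_0)$ of orthogonal projections in $\mathcal H_0$ with $P_0-Q_0=A_0$. For closed subspaces $\mathcal M,\mathcal N\subset\mathcal H$, the Friedrichs angle between them is the angle (in $[0,\pi/2]$) whose cosine is $$c(\mathcal M,\mathcal N)=\sup\{|\langle\mu,\nu\rangle|:\mu\in\mathcal M\ominus\mathcal N,\ \nu\in\mathcal N\ominus\mathcal M,\ \|\mu\|=\|\nu\|=1\}=\|P_{\mathcal M}P_{\mathcal N}-P_{\mathcal M\cap\mathcal N}\|,$$ where $\mathcal M\ominus\mathcal N=\mathcal M\cap(\mathcal M\cap\mathcal N)^\perp$ and $P_{\mathcal M}$ is the orthogonal projection onto $\mathcal M$. Halmos representation: there is an isometric isomorphism between $\mathcal H_0$ and a product $\mathcal L\times\mathcal L$ of a Hilbert space $\mathcal L$ with itself which carries $P_0$ and $Q_0$ to $\begin{pmatrix}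 1 & 0 \\ 0 & 0 \end{pmatrix}$ and $\begin{pmatrix} C^2 & CS \\ CS & S^2 \end{pmatrix}$, respectively, where $C=\cos(\Gamma)$, $S=\sin(\Gamma)$ and $0\le\Gamma\le\pi/2$ is a positive operator in $\mathcal L$ with trivial nullspace; $C$ and $S$ have trivial nullspaces.
   Formalization: Corrected: if Γ is non invertible the angle is 0 (not π/2); Γ invertible is equivalent to R(A), not R(A²−1), being closed; the formulas with ‖Γ⁻¹‖⁻¹ and the lowest spectral value assume the space L is nonzero. *)

(* Defs.v *)
From HB Require Import structures.
From mathcomp Require Import all_boot all_order all_algebra.
From mathcomp Require Import complex.
From mathcomp Require Import all_classical all_reals all_analysis.
Set Implicit Arguments.
Unset Strict Implicit.
Unset Printing Implicit Defensive.
Import Order.TTheory GRing.Theory Num.Theory.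
Import numFieldNormedType.Exports.
Local Open Scope classical_set_scope.
Local Open Scope complex_scope.
Local Open Scope ring_scope.

(* A complex Hilbert space: a Banach space over R[i] whose norm is induced by
   an inner product (linear in the first argument). *)
Record hilbert (R : realType) := Hilbert {
  hsort :> completeNormedModType R[i];
  ip : {dot hsort for @Num.conj R[i]};
  ip_norm : forall x : hsort, ip x x = `|x| ^+ 2 }.

Section HilbertOperators.
Context {R : realType}.
Implicit Types H L : hilbert R.

(* The library norm of a vector is an element of R[i]; hnorm is the same
   number, as an element of R. *)
Definition hnorm H (x : H) : R := complex.Re `|x|.

Definition ortho_compl H (M : set H) : set H :=
  [set x | forall y, M y -> ip H x y = 0].

(* An operator in a closed subspace M of H is represented by a function on H
   of which only the values on M matter; the restriction to M of an operator T
   reduced by M is then T itself, seen as an operator in M.  Operators in H are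
   operators in setT. *)
Definition bounded_op H (M : set H) (T : H -> H) : Prop :=
  [/\ forall x, M x -> M (T x),
      forall (a : R[i]) x y, M x -> M y -> T (a *: x + y) = a *: T x + T y
    & exists k : R, forall x, M x -> hnorm (T x) <= k * hnorm x].

Definition opnorm H (M : set H) (T : H -> H) : R :=
  sup [set hnorm (T x) | x in [set x | M x /\ hnorm x <= 1]].

Definition orthoproj H (M : set H) (P : H -> H) : Prop :=
  [/\ bounded_op M P,
      forall x, M x -> P (P x) = P x
    & forall x y, M x -> M y -> ip H (P x) y = ip H x (P y)].

Definition nullspace H (T : H -> H) : set H := [set x | T x = 0].

Definition diff_pairs H (M : set H) (A : H -> H) : set ((H -> H) * (H -> H)) :=
  [set PQ | [/\ orthoproj M PQ.1, orthoproj M PQ.2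
              & forall x, M x -> PQ.1 x - PQ.2 x = A x]].

Definition proj_diffs H : set (H -> H) :=
  [set A | exists P Q, [/\ orthoproj setT P, orthoproj setT Q
                         & A = (fun x => P x - Q x)]].

Definition generic_space H (A : H -> H) : set H :=
  ortho_compl [set x + y | x in nullspace A
                         & y in nullspace (fun z => A (A z) - z)].

Definition hominus H (M N : set H) : set H := M `&` ortho_compl (M `&` N).

(* sup set0 = 0, in accordance with |P_M P_N - P_(M cap N)| = 0 when one of
   the two subspaces contains the other. *)
Definition friedrichs_cos H (M N : set H) : R :=
  sup [set r | exists mu nu, [/\ hominus M N mu, hominus N M nu,
                 hnorm mu = 1, hnorm nu = 1 & r = complex.Re `|ip H mu nu| ]].

Definition friedrichs_angle H (M N : set H) : R := acos (friedrichs_cos M N).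

Definition inverse_op L (T G : L -> L) : Prop :=
  [/\ bounded_op setT G, forall x, G (T x) = x & forall x, T (G x) = x].

Definition invertible_op L (T : L -> L) : Prop := exists G, inverse_op T G.

Definition spectrum L (T : L -> L) : set R[i] :=
  [set l | ~ invertible_op (fun x => T x - l *: x)].

(* cos and sin of a bounded operator, by their everywhere convergent power
   series. *)
Definition opcos L (T : L -> L) (x : L) : L :=
  limn (series (fun k => ((-1) ^+ k / (k.*2)`!%:R : R[i]) *: iter k.*2 T x)).

Definition opsin L (T : L -> L) (x : L) : L :=
  limn (series (fun k =>
    ((-1) ^+ k / (k.*2.+1)`!%:R : R[i]) *: iter k.*2.+1 T x)).

(* L * L is used with its Hilbert norm; the library norm on a product is the
   max norm. *)
Definition prod_norm L (z : L * L) : R :=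
  Num.sqrt (hnorm z.1 ^+ 2 + hnorm z.2 ^+ 2).

Definition prod_opnorm L (T : L * L -> L * L) : R :=
  sup [set prod_norm (T z) | z in [set z | prod_norm z <= 1]].

Definition block_op L (T11 T12 T21 T22 : L -> L) (z : L * L) : L * L :=
  (T11 z.1 + T12 z.2, T21 z.1 + T22 z.2).

Definition zero_op L (x : L) : L := 0.

Definition isometric_iso H L (M : set H) (U : H -> L * L) : Prop :=
  [/\ set_bij M setT U,
      forall (a : R[i]) x y, M x -> M y -> U (a *: x + y) = a *: U x + U y
    & forall x, M x -> prod_norm (U x) = hnorm x].

(* Over the complex numbers, 0 <= <G x, x> for all x forces G to be
   self-adjoint. *)
Record halmos_rep H L (M : set H) (P Q : H -> H)
    (U : H -> L * L) (G : L -> L) : Prop := HalmosRep {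
  halmos_iso : isometric_iso M U;
  halmos_op : bounded_op setT G;
  halmos_ge0 : forall x, 0 <= ip L (G x) x;
  halmos_le : forall x, ip L (G x) x <= (pi / 2)%:C * ip L x x;
  halmos_null : nullspace G = [set 0];
  halmos_nullC : nullspace (opcos G) = [set 0];
  halmos_nullS : nullspace (opsin G) = [set 0];
  halmos_P : forall x, M x ->
    U (P x) = block_op id (@zero_op L) (@zero_op L) (@zero_op L) (U x);
  halmos_Q : forall x, M x ->
    U (Q x) = block_op (opcos G \o opcos G) (opcos G \o opsin G)
                       (opcos G \o opsin G) (opsin G \o opsin G) (U x) }.

End HilbertOperators.

(* Main.v *)
(** The cosine of the Friedrichs angle is the norm [c] of [P Q] on the generic
    subspace [H0], because [ker A] and [ker (A^2 - 1)] contribute nothing to it.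
    On [H0], [|x|^2 - |A x|^2 = |Q P x|^2 + |(1 - Q) (1 - P) x|^2], and both
    products have the same norm there, since [A] is injective and intertwines
    [P] with [1 - Q].  So [c] is the least [r >= 0] with
    [(1 - r^2) |x|^2 <= |A x|^2] on [H0]: it depends on [A] only, and it is less
    than 1 iff [A] is bounded below on [H0], i.e. iff [A] has closed range.
    Moreover [|P + Q| = 1 + c] on [H0] unless [H0 = 0].

    In a Halmos representation [c = |cos Gamma|].  Let [m] be the infimum of
    [<Gamma x, x>] over unit vectors.  It is an approximate eigenvalue of
    [Gamma], so [cos m] is one of [cos Gamma] and [cos m <= |cos Gamma|].  For
    the converse, a real polynomial [q] satisfies
    [|q(Gamma)| <= max_[m, pi/2] |q|]: factoring [q - l] over the complex numbers
    shows that [q(Gamma) - l] is bounded below when [q] does not take the value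
    [l] on [[m, pi/2]].  Hence [|cos Gamma| = cos m].  Finally [Gamma] is
    invertible iff [m > 0], and then [|Gamma^-1| = 1/m]. *)

Require Import Defs.
From HB Require Import structures.
From mathcomp Require Import all_boot all_order all_algebra.
From mathcomp Require Import complex ring lra.
From mathcomp Require Import all_classical all_reals all_analysis.
Set Implicit Arguments.
Unset Strict Implicit.
Unset Printing Implicit Defensive.
Import Order.TTheory GRing.Theory Num.Theory.
Import numFieldNormedType.Exports.
Local Open Scope classical_set_scope.
Local Open Scope complex_scope.
Local Open Scope ring_scope.

(** * Inner product geometry *)

(** The phase of [A] would be a unitary of [H0] carrying [ker Q] to [ran P], and would give at once
    the equality of the two product norms. No polar decomposition is built: the growth of the powers
    of [1 - A^2] is compared instead. Transport by [A] costs a constant factor, which the rate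
    [r^(2n)] does not see.

    That a closed range makes [A] bounded below on [H0] comes from uniform boundedness: the
    self-adjointness of [A] turns solvability of [A z = x] into weak boundedness of the vectors [w]
    of [H0] with [|A w| <= 1].

    Closed range of [A] is the condition matching invertibility of [Gamma], because [A^2] becomes
    [diag(S^2, S^2)] in the Halmos form and [sin Gamma] is invertible exactly when [Gamma] is. If
    [Gamma] is not invertible then [m = 0], the cosine is 1 and the angle is 0.

    The passage from polynomials to the cosine uses its Taylor polynomials, which converge uniformly
    on [[0, pi/2]]. *)

Section InnerProduct.
Context {R : realType} {H : hilbert R}.
Implicit Types (x y z : H) (a b : R).

(** A real inner product with the same norm. Estimates are made with it in the ordered field [R];
    complex orthogonality is recovered by testing against ['i *: x] as well. *)
Definition rip x y : R := complex.Re (ip H x y).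

Lemma ReD (u v : R[i]) : complex.Re (u + v) = complex.Re u + complex.Re v.
Proof. by case: u; case: v. Qed.

Lemma ReN (u : R[i]) : complex.Re (- u) = - complex.Re u.
Proof. by case: u. Qed.

Lemma ReZ a (u : R[i]) : complex.Re (a%:C * u) = a * complex.Re u.
Proof. by case: u => u v /=; rewrite mul0r subr0. Qed.

Lemma normc_Re (u : R[i]) : `|u| = (complex.Re `|u|)%:C.
Proof. by rewrite RRe_real// normr_real. Qed.

Lemma normv_hnorm x : `|x| = (hnorm x)%:C.
Proof. by rewrite /hnorm RRe_real// ger0_real. Qed.

Lemma ipxx x : ip H x x = (hnorm x ^+ 2)%:C.
Proof. by rewrite ip_norm normv_hnorm rmorphXn. Qed.

Lemma ipC x y : ip H x y = (ip H y x)^*%R.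
Proof. by rewrite hermC expr0 mul1r. Qed.

Lemma ripxx x : rip x x = hnorm x ^+ 2.
Proof. by rewrite /rip ipxx. Qed.

Lemma conjcE (u : R[i]) : (u^*)%R = conjc u.
Proof. by []. Qed.

Lemma Re_conj (u : R[i]) : complex.Re (u^*)%R = complex.Re u.
Proof. by rewrite conjcE; case: u. Qed.

Lemma ripC x y : rip x y = rip y x.
Proof. by rewrite /rip ipC Re_conj. Qed.

Lemma ripDl x y z : rip (x + y) z = rip x z + rip y z.
Proof. by rewrite /rip linearDl ReD. Qed.

Lemma ripDr z x y : rip z (x + y) = rip z x + rip z y.
Proof. by rewrite ripC ripDl !(ripC _ z). Qed.

Lemma ripNl x z : rip (- x) z = - rip x z.
Proof. by rewrite /rip linearNl ReN. Qed.

Lemma ripNr z x : rip z (- x) = - rip z x.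
Proof. by rewrite ripC ripNl ripC. Qed.

Lemma ripBl x y z : rip (x - y) z = rip x z - rip y z.
Proof. by rewrite ripDl ripNl. Qed.

Lemma ripBr z x y : rip z (x - y) = rip z x - rip z y.
Proof. by rewrite ripDr ripNr. Qed.

Lemma ripZl a x z : rip (a%:C *: x) z = a * rip x z.
Proof. by rewrite /rip linearZl_LR /= ReZ. Qed.

Lemma ripZr a z x : rip z (a%:C *: x) = a * rip z x.
Proof. by rewrite ripC ripZl ripC. Qed.

Definition ripE := (ripDl, ripDr, ripNl, ripNr, ripZl, ripZr).

Lemma rip0l x : rip 0 x = 0.
Proof. by rewrite /rip linear0l. Qed.

Lemma rip0r x : rip x 0 = 0.
Proof. by rewrite ripC rip0l. Qed.

Lemma hnorm_ge0 x : 0 <= hnorm x.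
Proof. by rewrite -ler0c -normv_hnorm. Qed.

Lemma hnorm0 : hnorm (0 : H) = 0.
Proof. by rewrite /hnorm normr0. Qed.

Lemma hnorm_eq0 x : (hnorm x == 0) = (x == 0).
Proof. by rewrite -(inj_eq (@complexI R)) -normv_hnorm normr_eq0. Qed.

Lemma hnorm_gt0 x : (0 < hnorm x) = (x != 0).
Proof. by rewrite lt_neqAle hnorm_ge0 andbT eq_sym hnorm_eq0. Qed.

Lemma hnorm_opp x : hnorm (- x) = hnorm x.
Proof. by rewrite /hnorm normrN. Qed.

Lemma hnorm_sub x y : hnorm (x - y) = hnorm (y - x).
Proof. by rewrite -hnorm_opp opprB. Qed.

Lemma hnormZc (c : R[i]) x : hnorm (c *: x) = complex.Re `|c| * hnorm x.
Proof. by rewrite {1}/hnorm normrZ normc_Re ReZ. Qed.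

Lemma hnormZ a x : hnorm (a%:C *: x) = `|a| * hnorm x.
Proof. by rewrite hnormZc normc_def /= expr0n addr0 sqrtr_sqr. Qed.

Lemma hnorm_triangle x y : hnorm (x + y) <= hnorm x + hnorm y.
Proof. by rewrite -lecR rmorphD /= -!normv_hnorm ler_normD. Qed.

Lemma hnorm_triangleB x y : hnorm (x - y) <= hnorm x + hnorm y.
Proof. by rewrite (le_trans (hnorm_triangle _ _))// hnorm_opp. Qed.

Lemma hnorm_triangle_sub y x z : hnorm (x - z) <= hnorm (x - y) + hnorm (y - z).
Proof. by rewrite -{1}(subrK y x) -addrA hnorm_triangle. Qed.

Lemma hnorm_sum I (r : seq I) (F : I -> H) :
  hnorm (\sum_(i <- r) F i) <= \sum_(i <- r) hnorm (F i).
Proof.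
elim/big_ind2: _ => [|x a y b xa yb|//]; first by rewrite hnorm0.
by rewrite (le_trans (hnorm_triangle _ _))// lerD.
Qed.

Lemma sqr_hnormD x y :
  hnorm (x + y) ^+ 2 = hnorm x ^+ 2 + 2 * rip x y + hnorm y ^+ 2.
Proof. by rewrite -!ripxx !ripE (ripC y x); ring. Qed.

Lemma sqr_hnormB x y :
  hnorm (x - y) ^+ 2 = hnorm x ^+ 2 - 2 * rip x y + hnorm y ^+ 2.
Proof. by rewrite sqr_hnormD hnorm_opp ripNr; ring. Qed.

Lemma ler_sqr_hnorm x b : 0 <= b -> (hnorm x <= b) = (hnorm x ^+ 2 <= b ^+ 2).
Proof. by move=> b0; rewrite ler_sqr// nnegrE ?hnorm_ge0. Qed.

(** Expand the square of the norm of [|y| x - |x| y], which is nonnegative. *)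
Lemma rip_le x y : rip x y <= hnorm x * hnorm y.
Proof.
have [->|x0] := eqVneq x 0; first by rewrite rip0l hnorm0 mul0r.
have [->|y0] := eqVneq y 0; first by rewrite rip0r hnorm0 mulr0.
have px : 0 < hnorm x by rewrite hnorm_gt0.
have py : 0 < hnorm y by rewrite hnorm_gt0.
have := sqr_ge0 (hnorm ((hnorm y)%:C *: x - (hnorm x)%:C *: y)).
rewrite sqr_hnormB !hnormZ !ripE !ger0_norm ?hnorm_ge0// => h.
have : 0 <= 2 * (hnorm x * hnorm y) * (hnorm x * hnorm y - rip x y).
  by move: h; congr (0 <= _); ring.
by rewrite pmulr_rge0 ?subr_ge0// !mulr_gt0.
Qed.

Lemma norm_rip_le x y : `|rip x y| <= hnorm x * hnorm y.
Proof.
rewrite ler_norml rip_le andbT lerNl -ripNl.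
by rewrite (le_trans (rip_le _ _))// hnorm_opp.
Qed.

Lemma Re_normc_ge0 (u : R[i]) : 0 <= complex.Re `|u|.
Proof. by rewrite -ler0c -normc_Re. Qed.

Lemma norm_ip_le x y : complex.Re `|ip H x y| <= hnorm x * hnorm y.
Proof.
have [->|u0] := eqVneq (ip H x y) 0.
  by rewrite normr0 /= mulr_ge0 ?hnorm_ge0.
set u := ip H x y in u0 *.
(* Rotating [x] by the unimodular scalar [conj u / |u|] makes the inner product equal to its own
   modulus. *)
have n1 : complex.Re `|(u^*)%R / `|u| | = 1.
  by rewrite normrM normfV normr_id norm_conjC divff// normr_eq0.
have e : ip H (((u^*)%R / `|u|) *: x) y = `|u|.
  rewrite linearZl_LR /= -/u mulrAC [_ * u]mulrC -normCK expr2 mulfK//.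
  by rewrite normr_eq0.
by rewrite -e (le_trans (rip_le _ _))// hnormZc n1 mul1r.
Qed.

Lemma Re_normc_geRe (u : R[i]) : `|complex.Re u| <= complex.Re `|u|.
Proof. by rewrite -lecR -normc_Re normc_ge_Re. Qed.

Lemma rip_le_norm_ip x y : `|rip x y| <= complex.Re `|ip H x y|.
Proof. exact: Re_normc_geRe. Qed.

Lemma Im_ip x y : complex.Im (ip H x y) = - rip ('i *: x) y.
Proof. by rewrite /rip linearZl_LR /=; case: (ip H x y) => u v /=; ring. Qed.

Lemma ip_eq0 x y : rip x y = 0 -> rip ('i *: x) y = 0 -> ip H x y = 0.
Proof.
move=> h1 h2; apply/eqP; rewrite eq_complex /= -/(rip x y) h1 Im_ip h2 oppr0.
by rewrite !eqxx.
Qed.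

Lemma ip_sym0 x y : ip H x y = 0 -> ip H y x = 0.
Proof. by move=> h; rewrite ipC h conjC0. Qed.

Lemma eq_hnorm0 x : hnorm x <= 0 -> x = 0.
Proof. by move=> h; apply/eqP; rewrite -hnorm_eq0 eq_le h hnorm_ge0. Qed.

(** The form in which density and limit arguments end below; [b] may vanish. *)
Lemma le_mulr_eps a b : 0 <= b -> (forall e, 0 < e -> a <= e * b) -> a <= 0.
Proof.
rewrite le_eqVlt => /orP[/eqP<- /(_ 1 ltr01)|b0 h]; first by rewrite mulr0.
apply/ler_addgt0Pl => e e0; rewrite addr0.
by have := h (e / b) (divr_gt0 e0 b0); rewrite divfK// gt_eqF.
Qed.

End InnerProduct.

(** * Closed subspaces and orthogonal projection *)

Section Completeness.
Context {R : realType} {H : hilbert R}.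
Implicit Types (x y z : H) (a b e : R).

Lemma gt0c_real (c : R[i]) : 0 < c -> exists2 e : R, 0 < e & c = e%:C.
Proof.
move=> c0; exists (complex.Re c); last by rewrite RRe_real// gtr0_real.
by rewrite -ltcR RRe_real// gtr0_real.
Qed.

Lemma cvg_hnormP (u : nat -> H) x :
  u @ \oo --> x <->
  forall e, 0 < e -> exists N, forall n, (N <= n)%N -> hnorm (u n - x) < e.
Proof.
split.
  move=> /cvgrPdist_lt h e e0.
  have [|N _ hN] := h e%:C; first by rewrite ltcR.
  exists N => n Nn; have := hN n Nn.
  by rewrite /= normv_hnorm ltcR hnorm_sub.
move=> h; apply/cvgrPdist_lt => c /gt0c_real[e e0 ->].
have [N hN] := h e e0; exists N => // n Nn /=.
by rewrite normv_hnorm ltcR hnorm_sub hN.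
Qed.

Lemma cauchy_hnorm_cvg (u : nat -> H) :
  (forall e, 0 < e -> exists N, forall n, (N <= n)%N -> hnorm (u n - u N) < e) ->
  exists x, u @ \oo --> x.
Proof.
move=> h; suff : cvg (u @ \oo) by exists (lim (u @ \oo)).
apply/cauchy_cvgP/cauchyP => c /gt0c_real[e e0 ->].
have [N hN] := h e e0; exists (u N); exists N => // n Nn.
by rewrite /= -ball_normE /ball_ /= normv_hnorm ltcR hnorm_sub hN.
Qed.

Lemma closed_hnormP (M : set H) :
  closed M <->
  forall y, (forall e, 0 < e -> exists2 x, M x & hnorm (x - y) < e) -> M y.
Proof.
split=> cM y h; apply: cM.
  move=> B /nbhs_normP[c /= /gt0c_real[e e0 ->]] hB.
  have [x Mx xy] := h e e0; exists x; split=> //; apply: hB => /=.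
  by rewrite normv_hnorm ltcR hnorm_sub.
move=> e e0; have [|x [Mx xy]] := h (ball y e%:C).
  by apply: nbhsx_ballx; rewrite ltcR.
exists x => //; move: xy.
by rewrite -ball_normE /ball_ /= normv_hnorm ltcR hnorm_sub.
Qed.

Lemma invSn_lt e : 0 < e ->
  exists N, forall n, (N <= n)%N -> n.+1%:R^-1 < e.
Proof.
move=> e0; exists (Num.bound e^-1) => n Nn.
rewrite invf_plt ?posrE ?ltr0n// (lt_le_trans (archi_boundP _))//.
  by rewrite invr_ge0 ltW.
by rewrite ler_nat leqW.
Qed.

Definition lsubspace (M : set H) : Prop :=
  M 0 /\ forall (c : R[i]) x y, M x -> M y -> M (c *: x + y).

Definition closed_subspace (M : set H) : Prop := lsubspace M /\ closed M.

Lemma subspaceD (M : set H) x y : lsubspace M -> M x -> M y -> M (x + y).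
Proof. by move=> [_ h] /(h 1) + /[dup] My => /[apply]; rewrite scale1r. Qed.

Lemma subspaceZ (M : set H) (c : R[i]) x : lsubspace M -> M x -> M (c *: x).
Proof. by move=> [M0 h] /(h c) /(_ M0); rewrite addr0. Qed.

Lemma subspaceN (M : set H) x : lsubspace M -> M x -> M (- x).
Proof. by move=> sM /(subspaceZ (-1) sM); rewrite scaleN1r. Qed.

Lemma subspaceB (M : set H) x y : lsubspace M -> M x -> M y -> M (x - y).
Proof. by move=> sM Mx My; apply: (subspaceD sM Mx); apply: subspaceN. Qed.

Lemma closed_subspace_setT : closed_subspace setT.
Proof. by split=> //; apply: closedT. Qed.

Lemma ortho_compl_closed (M : set H) : closed_subspace (ortho_compl M).
Proof.
split; first split=> [y My|c x y hx hy z Mz]; first by rewrite linear0l.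
  by rewrite linearDl linearZl_LR /= hx// hy// mulr0 addr0.
apply/closed_hnormP => x h y My.
suff : complex.Re `|ip H x y| <= 0.
  move=> h0; apply/eqP; rewrite -normr_eq0 normc_Re.
  have -> : complex.Re `|ip H x y| = 0; last by [].
  by apply/eqP; rewrite eq_le h0 Re_normc_ge0.
apply: (@le_mulr_eps _ _ (hnorm y)) => [|e e0]; first exact: hnorm_ge0.
have [z hz zx] := h e e0.
have -> : ip H x y = ip H (x - z) y by rewrite linearBl /= hz// subr0.
rewrite (le_trans (norm_ip_le _ _))// ler_wpM2r ?hnorm_ge0// ltW//.
by rewrite hnorm_sub.
Qed.

Lemma closed_subspaceI (M N : set H) :
  closed_subspace M -> closed_subspace N -> closed_subspace (M `&` N).
Proof.
move=> [[M0 hM] cM] [[N0 hN] cN]; split; last exact: closedI.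
by split=> [|c x y [Mx Nx] [My Ny]]; split; [| |exact: hM|exact: hN].
Qed.

(** A complex subspace contains ['i *: y] along with [y], so vanishing real parts already give
    vanishing inner products. *)
Lemma ortho_rip (M : set H) x : lsubspace M ->
  (forall y, M y -> rip x y = 0) -> ortho_compl M x.
Proof.
move=> sM h y My; apply: ip_eq0; first exact: h.
have := h ('i *: y) (subspaceZ 'i sM My).
rewrite /rip linearZr_LR linearZl_LR /=; case: (ip H x y) => u v /=.
by rewrite !mul0r !mulN1r mul1r opprK sub0r add0r => ->; rewrite oppr0.
Qed.

Lemma projection_theorem (M : set H) x : closed_subspace M ->
  exists2 p, M p & ortho_compl M (x - p).
Proof.
move=> [sM /closed_hnormP cM].
pose D := [set hnorm (x - y) | y in M].
have D0 : has_inf D.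
  split; first by exists (hnorm (x - 0)); exists 0 => //; case: sM.
  by exists 0 => _ [y _ <-]; exact: hnorm_ge0.
pose d := inf D.
have d0 : 0 <= d.
  by apply: lb_le_inf; [case: D0|move=> _ [y _ <-]; exact: hnorm_ge0].
have dle y : M y -> d <= hnorm (x - y).
  by move=> My; apply: ge_inf; [case: D0|exists y].
have /choice[u hu] n : exists y, M y /\ hnorm (x - y) < d + n.+1%:R^-1.
  have [|_ [y My <-] hy] := @inf_adherent _ D n.+1%:R^-1 _ D0.
    by rewrite invr_gt0 ltr0n.
  by exists y.
(* The midpoint of [y] and [z] is in [M], hence at distance at least [d] from [x]; the parallelogram
   law leaves [4 (d + e)^2 - 4 d^2]. *)
have parallelogram y z e : M y -> M z -> hnorm (x - y) <= d + e ->
    hnorm (x - z) <= d + e -> hnorm (y - z) ^+ 2 <= 4 * e * (2 * d + e).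
  move=> My Mz hy hz.
  have yz : d <= hnorm (x - (2^-1 : R)%:C *: (y + z)).
    exact/dle/(subspaceZ _ sM)/(subspaceD sM).
  have e1 : (x - y) + (x - z) = (2 : R)%:C *: (x - (2^-1 : R)%:C *: (y + z)).
    rewrite scalerBr scalerA -rmorphM /= divff// scale1r.
    by rewrite rmorphD /= scalerDl !scale1r opprD addrACA.
  have e2 : y - z = (x - z) - (x - y) by rewrite opprB [RHS]addrC addrA subrK.
  have h1 := sqr_hnormD (x - y) (x - z).
  have h2 := sqr_hnormB (x - z) (x - y).
  rewrite e1 hnormZ exprMn in h1; rewrite e2 h2 (ripC (x - z)).
  have h3 : d ^+ 2 <= hnorm (x - (2^-1 : R)%:C *: (y + z)) ^+ 2.
    by rewrite ler_sqr ?nnegrE ?hnorm_ge0.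
  have h4 : hnorm (x - y) ^+ 2 <= (d + e) ^+ 2.
    by rewrite ler_sqr ?nnegrE ?hnorm_ge0// (le_trans _ hy)// hnorm_ge0.
  have h5 : hnorm (x - z) ^+ 2 <= (d + e) ^+ 2.
    by rewrite ler_sqr ?nnegrE ?hnorm_ge0// (le_trans _ hz)// hnorm_ge0.
  rewrite ger0_norm// in h1.
  nra.
have [p hp] : exists p : H, u @ \oo --> p.
  apply: cauchy_hnorm_cvg => e e0.
  (* With [f <= 1] and [f < c], the bound [4 f (2 d + f)] is below [e^2]. *)
  pose c := e ^+ 2 / (4 * (2 * d + 1)).
  have c0 : 0 < c by rewrite divr_gt0 ?exprn_gt0//; lra.
  have [|N hN] := @invSn_lt (Num.min 1 c); first by rewrite lt_min ltr01.
  exists N => n Nn.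
  have [un hn] := hu n; have [uN hhN] := hu N.
  pose f := N.+1%:R^-1 : R.
  have f0 : 0 < f by rewrite invr_gt0 ltr0n.
  have := hN N (leqnn _); rewrite lt_min -/f => /andP[f1 fc].
  have h : hnorm (u n - u N) ^+ 2 <= 4 * f * (2 * d + f).
    apply: parallelogram => //; apply/ltW => //.
    rewrite (lt_le_trans hn)// lerD2l lef_pV2 ?posrE ?ltr0n//.
    by rewrite ler_nat ltnS.
  rewrite -ltr_sqr ?nnegrE ?hnorm_ge0//; last exact: ltW.
  rewrite (le_lt_trans h)//.
  move: fc; rewrite /c ltr_pdivlMr; last lra.
  nra.
have /cvg_hnormP hp' := hp.
exists p.
  apply: cM => e /hp'[N /(_ N (leqnn N)) hN].
  by exists (u N) => //; case: (hu N).
have pd : hnorm (x - p) <= d.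
  apply/ler_addgt0Pl => e e0.
  have e20 : 0 < e / 2 by rewrite divr_gt0.
  have [N hN] := hp' (e / 2) e20.
  have [K hK] := invSn_lt e20.
  pose N2 := maxn N K.
  have hN2 := hN N2 (leq_maxl _ _).
  have [_ h2] := hu N2.
  have h3 : N2.+1%:R^-1 < e / 2 by apply: hK; rewrite leq_maxr.
  move: (N2.+1%:R^-1) h2 h3 => q h2 h3.
  by have := hnorm_triangle_sub (u N2) x p; lra.
have Mp : M p.
  apply: cM => e /hp'[N /(_ N (leqnn N)) hN].
  by exists (u N) => //; case: (hu N).
apply: ortho_rip => // y My.
have [->|y0] := eqVneq y 0; first by rewrite rip0r.
have py : 0 < hnorm y by rewrite hnorm_gt0.
(* The optimal step from [p] in the direction [y]: it lowers the squared distance by [t^2 |y|^2], so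
   minimality forces [t = 0]. *)
pose t := rip (x - p) y / hnorm y ^+ 2.
have := dle (p + t%:C *: y) (subspaceD sM Mp (subspaceZ _ sM My)).
rewrite opprD addrA => /(le_trans pd).
rewrite -ler_sqr ?nnegrE ?hnorm_ge0//.
rewrite (sqr_hnormB (x - p)) hnormZ ripZr exprMn -normrX ger0_norm ?sqr_ge0//.
have <- : t * hnorm y ^+ 2 = rip (x - p) y.
  by rewrite /t divfK// expf_neq0// gt_eqF.
move=> h; have {}h : t ^+ 2 * hnorm y ^+ 2 <= 0 by nra.
have : t ^+ 2 <= 0 by rewrite -(pmulr_lle0 _ (exprn_gt0 2 py)).
by rewrite le_eqVlt ltNge sqr_ge0 orbF sqrf_eq0 => /eqP->; rewrite mul0r.
Qed.

End Completeness.

(** * Bounded operators *)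

Section Operators.
Context {R : realType} {H : hilbert R}.
Implicit Types (x y z : H) (a b e k : R) (M : set H) (S T : H -> H).

Lemma cvg_closed M (u : nat -> H) x :
  closed M -> (forall n, M (u n)) -> u @ \oo --> x -> M x.
Proof.
move=> /closed_hnormP cM Mu /cvg_hnormP ux; apply: cM => e /ux[N hN].
by exists (u N) => //; exact: hN.
Qed.

Lemma bounded_op0 M T : lsubspace M -> bounded_op M T -> T 0 = 0.
Proof.
move=> [M0 _] [_ lT _]; have := lT 1 0 0 M0 M0.
by rewrite scale1r addr0 scale1r => /eqP; rewrite -subr_eq subrr eq_sym => /eqP.
Qed.

Lemma bounded_opD M T x y : bounded_op M T -> M x -> M y ->
  T (x + y) = T x + T y.
Proof. by move=> [_ lT _] Mx My; have := lT 1 x y Mx My; rewrite !scale1r. Qed.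

Lemma bounded_opZ M T (c : R[i]) x : lsubspace M -> bounded_op M T -> M x ->
  T (c *: x) = c *: T x.
Proof.
move=> sM bT Mx; have [M0 _] := sM; have [_ lT _] := bT.
by rewrite -[c *: x]addr0 lT// (bounded_op0 sM bT) addr0.
Qed.

Lemma bounded_opN M T x : lsubspace M -> bounded_op M T -> M x -> T (- x) = - T x.
Proof. by move=> sM bT Mx; rewrite -scaleN1r (bounded_opZ _ sM bT)// scaleN1r. Qed.

Lemma bounded_opB M T x y : lsubspace M -> bounded_op M T -> M x -> M y ->
  T (x - y) = T x - T y.
Proof.
move=> sM bT Mx My; rewrite (bounded_opD bT)//; last exact: subspaceN.
by rewrite (bounded_opN sM bT).
Qed.

Lemma bounded_op_bound M T : bounded_op M T ->
  exists2 k, 0 < k & forall x, M x -> hnorm (T x) <= k * hnorm x.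
Proof.
move=> [_ _ [k hk]]; exists (`|k| + 1); first by rewrite ltr_wpDl.
move=> x /hk /le_trans-> //; rewrite ler_wpM2r ?hnorm_ge0//.
by rewrite (le_trans (ler_norm _))// lerDl.
Qed.

Lemma bounded_op_comp M S T : bounded_op M S -> bounded_op M T ->
  bounded_op M (S \o T).
Proof.
move=> bS bT; have [MS lS _] := bS; have [MT lT _] := bT.
have [k k0 hk] := bounded_op_bound bS; have [l l0 hl] := bounded_op_bound bT.
split=> [x Mx|c x y Mx My|]; first exact/MS/MT.
  by rewrite /= lT// lS//; apply: MT.
exists (k * l) => x Mx; rewrite -mulrA (le_trans (hk _ (MT _ Mx)))//.
by rewrite ler_pM2l// hl.
Qed.

Lemma bounded_op_lin M S T (c : R[i]) : lsubspace M ->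
  bounded_op M S -> bounded_op M T -> bounded_op M (fun x => c *: S x + T x).
Proof.
move=> sM bS bT; have [MS lS _] := bS; have [MT lT _] := bT.
have [k k0 hk] := bounded_op_bound bS; have [l l0 hl] := bounded_op_bound bT.
split=> [x Mx|d x y Mx My|].
- by case: sM => _; apply; [exact: MS|exact: MT].
- rewrite lS// lT// !scalerDr !scalerA [d * c]mulrC !addrA; congr (_ + _).
  by rewrite -!addrA; congr (_ + _); rewrite addrC.
exists (complex.Re `|c| * k + l) => x Mx.
rewrite (le_trans (hnorm_triangle _ _))// hnormZc mulrDl lerD ?hl//.
by rewrite -mulrA ler_wpM2l ?hk// Re_normc_ge0.
Qed.

Lemma bounded_op_id M : lsubspace M -> bounded_op M id.
Proof. by move=> sM; split=> //; exists 1 => x _; rewrite mul1r. Qed.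

Lemma opnorm_has_sup M T : lsubspace M -> bounded_op M T ->
  has_sup [set hnorm (T x) | x in [set x | M x /\ hnorm x <= 1]].
Proof.
move=> [M0 _] bT; split.
  by exists (hnorm (T 0)), 0 => //; split=> //; rewrite hnorm0.
have [k k0 hk] := bounded_op_bound bT.
exists k => _ [x [Mx x1] <-]; apply: le_trans (hk _ Mx) _.
by rewrite ler_piMr// ltW.
Qed.

Lemma opnorm_bound M T x : lsubspace M -> bounded_op M T -> M x ->
  hnorm (T x) <= opnorm M T * hnorm x.
Proof.
move=> sM bT Mx; have [->|x0] := eqVneq x 0.
  by rewrite (bounded_op0 sM bT) hnorm0 mulr0.
have px : 0 < hnorm x by rewrite hnorm_gt0.
rewrite -ler_pdivrMr// mulrC.
have -> : (hnorm x)^-1 * hnorm (T x) = hnorm (T ((hnorm x)^-1%:C *: x)).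
  by rewrite (bounded_opZ _ sM bT)// hnormZ gtr0_norm// invr_gt0.
apply: ub_le_sup; first by case: (opnorm_has_sup sM bT).
exists ((hnorm x)^-1%:C *: x) => //; split; first exact: subspaceZ.
by rewrite hnormZ gtr0_norm ?invr_gt0// mulVf// gt_eqF.
Qed.

Lemma opnorm_le M T k : lsubspace M -> 0 <= k ->
  (forall x, M x -> hnorm (T x) <= k * hnorm x) -> opnorm M T <= k.
Proof.
move=> [M0 _] k0 hk; apply: ge_sup.
  by exists (hnorm (T 0)), 0 => //; split=> //; rewrite hnorm0.
by move=> _ [x [Mx x1] <-]; rewrite (le_trans (hk _ Mx))// ler_piMr.
Qed.

Lemma opnorm_ge0 M T : 0 <= opnorm M T.
Proof.
rewrite /opnorm; have [hs|/sup_out->//] := pselect (has_sup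
  [set hnorm (T x) | x in [set x | M x /\ hnorm x <= 1]]).
have [[r [x Mx _]] ub] := hs; rewrite (le_trans (hnorm_ge0 (T x)))//.
by apply: ub_le_sup => //; exists x.
Qed.

Lemma opnorm_ext M S T : (forall x, M x -> S x = T x) ->
  opnorm M S = opnorm M T.
Proof.
move=> ST; rewrite /opnorm; congr sup; apply/seteqP.
by split=> _ [x [Mx x1] <-]; exists x => //; rewrite ST.
Qed.

(** Approximate preimages of a limit point form a Cauchy sequence. The sign of [k] is free, so the
    proof divides by [|k| + 1] instead. *)
Lemma closed_image M T k : bounded_op setT T -> closed_subspace M ->
  (forall x, M x -> hnorm x <= k * hnorm (T x)) -> closed (T @` M).
Proof.
move=> bT [sM cM] hk; apply/closed_hnormP => y hy.
have sT := (@closed_subspace_setT R H).1.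
have [l l0 hl] := bounded_op_bound bT.
have hk' x : M x -> hnorm x <= (`|k| + 1) * hnorm (T x).
  move=> /hk /le_trans-> //; rewrite ler_wpM2r ?hnorm_ge0//.
  by rewrite (le_trans (ler_norm _))// lerDl.
have k0 : 0 < `|k| + 1 by rewrite ltr_wpDl.
move: (`|k| + 1) k0 hk' => {hk}k k0 hk.
have /choice[u hu] n : exists x, M x /\ hnorm (T x - y) < n.+1%:R^-1.
  have [|_ [x Mx <-] hx] := hy n.+1%:R^-1; first by rewrite invr_gt0 ltr0n.
  by exists x.
have [x hx] : exists x : H, u @ \oo --> x.
  apply: cauchy_hnorm_cvg => e e0.
  have [|N hN] := @invSn_lt _ (e / (2 * k)); first by rewrite divr_gt0 ?mulr_gt0.
  exists N => n Nn; have [Mn Tn] := hu n; have [MN TN] := hu N.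
  have h1 := hk _ (subspaceB sM Mn MN); rewrite (bounded_opB sT bT)// in h1.
  have h2 := hnorm_triangle_sub y (T (u n)) (T (u N)).
  rewrite (hnorm_sub y) in h2.
  have h3 : hnorm (T (u n) - T (u N)) < e / k.
    have := hN n Nn; have := hN N (leqnn N); rewrite invfM mulrA.
    move: (_.+1%:R^-1) (_.+1%:R^-1) Tn TN => p q; move: (k^-1) => k'; lra.
  by rewrite (le_lt_trans h1)// mulrC -ltr_pdivlMr.
have Mx : M x by apply: cvg_closed hx => // n; case: (hu n).
exists x => //; apply/eqP; rewrite -subr_eq0 -hnorm_eq0 eq_le hnorm_ge0 andbT.
apply: (@le_mulr_eps _ _ (l + 1)) => [|e e0]; first by rewrite addr_ge0// ltW.
have /cvg_hnormP/(_ e e0)[N1 hN1] := hx.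
have [N2 hN2] := invSn_lt e0.
have := hN1 _ (leq_maxl N1 N2); have := hN2 _ (leq_maxr N1 N2).
move: (maxn N1 N2) => n h2 h1; have [_ h3] := hu n.
have h4 := hnorm_triangle_sub (T (u n)) (T x) y.
have h5 : hnorm (T x - T (u n)) <= l * hnorm (u n - x).
  by rewrite -(bounded_opB sT bT)// (hnorm_sub (u n)) hl.
have h6 : l * hnorm (u n - x) <= l * e by rewrite ler_pM2l// ltW.
by move: (_.+1%:R^-1) h2 h3 => q h2 h3; lra.
Qed.

Lemma range_subspace T : bounded_op setT T -> lsubspace (range T).
Proof.
move=> bT; have sT := (@closed_subspace_setT R H).1; have [_ lT _] := bT.
split; first by exists 0 => //; exact: bounded_op0 bT.
by move=> c _ _ [x _ <-] [y _ <-]; exists (c *: x + y) => //; rewrite lT.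
Qed.

Lemma coercive_below T d x : d * hnorm x ^+ 2 <= complex.Re `|ip H (T x) x| ->
  d * hnorm x <= hnorm (T x).
Proof.
have [->|x0] := eqVneq x 0; first by rewrite hnorm0 mulr0 hnorm_ge0.
have px : 0 < hnorm x by rewrite hnorm_gt0.
move=> /le_trans /(_ (norm_ip_le _ _)); rewrite expr2 mulrA.
by rewrite ler_pM2r.
Qed.

(** The range is closed because [T] is bounded below, and a vector [v] orthogonal to it satisfies
    [d |v|^2 <= |<T v, v>| = 0]. *)
Lemma lax_milgram T d : bounded_op setT T -> 0 < d ->
  (forall x, d * hnorm x ^+ 2 <= complex.Re `|ip H (T x) x|) ->
  invertible_op T.
Proof.
move=> bT d0 hd; have cT := @closed_subspace_setT R H.
have [sT _] := cT; have [_ lT _] := bT.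
have below x : hnorm x <= d^-1 * hnorm (T x).
  by rewrite ler_pdivlMl// coercive_below.
have cR : closed_subspace (range T).
  split; first exact: range_subspace.
  by apply: (closed_image bT cT (k := d^-1)) => x _.
have /choice[G hG] y : exists x, T x = y.
  have [_ [x _ <-] hp] := projection_theorem y cR.
  exists x; apply/eqP; rewrite eq_sym -subr_eq0 -hnorm_eq0 -sqrf_eq0 eq_le.
  rewrite sqr_ge0 andbT -(pmulr_rle0 _ d0) (le_trans (hd _))//.
  by rewrite (@ip_sym0 _ _ (y - T x))// ?normr0//; apply: hp; exists (y - T x).
have inj x y : T x = T y -> x = y.
  move=> e; apply/eqP; rewrite -subr_eq0; apply/eqP/eq_hnorm0.
  by rewrite (le_trans (below _))// (bounded_opB sT bT)// e subrr hnorm0 mulr0.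
exists G; split=> [|x|//]; last by apply: inj; rewrite hG.
split=> [//|c x y _ _|]; first by apply: inj; rewrite hG lT// !hG.
by exists d^-1 => x _; rewrite (le_trans (below _))// hG.
Qed.

Lemma inverse_op_below T G : inverse_op T G ->
  exists2 d, 0 < d & forall x, d * hnorm x <= hnorm (T x).
Proof.
move=> [bG GT _]; have [k k0 hk] := bounded_op_bound bG.
exists k^-1; first by rewrite invr_gt0.
by move=> x; rewrite ler_pdivrMl// -{1}(GT x) hk.
Qed.

(* Gliding hump: [u] moves by [3^-n] in the direction of the n-th vector of a
   sequence in [W] growing faster than [n 3^n]; the later moves can only undo
   half of this. *)
Lemma weakly_bounded (W : set H) :
  (forall x, exists k, forall w, W w -> `|rip x w| <= k) ->
  exists k, forall w, W w -> hnorm w <= k.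
Proof.
move=> wb; apply: contrapT => /forallNP nb.
pose q n : R := (3 ^+ n)^-1.
have q0 n : 0 < q n by rewrite invr_gt0 exprn_gt0.
have qS n : q n.+1 = q n / 3 by rewrite /q exprS invfM mulrC.
have /choice[w hw] n : exists v, W v /\ n%:R * 3 ^+ n < hnorm v.
  have /existsNP[v /not_implyP[Wv /negP]] := nb (n%:R * 3 ^+ n).
  by rewrite -ltNge; exists v.
have w0 n : 0 < hnorm (w n).
  by case: (hw n) => _; apply: le_lt_trans; rewrite mulr_ge0// exprn_ge0.
(* The sign makes the step add to the absolute value of [rip x (w n)] instead of cancelling it. *)
pose s x n : R := if 0 <= rip x (w n) then 1 else -1.
pose step x n := (s x n * (q n / hnorm (w n)))%:C *: w n.
pose fix u n : H := if n is m.+1 then u m + step (u m) m else 0.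
have step_norm x n : hnorm (step x n) = q n.
  rewrite /step hnormZ normrM.
  have -> : `|s x n| = 1 by rewrite /s; case: ifP; rewrite ?normrN normr1.
  by rewrite mul1r ger0_norm ?divfK ?gt_eqF// ltW// divr_gt0.
have step_rip x n : q n * hnorm (w n) <= `|rip (x + step x n) (w n)|.
  rewrite ripDl ripZl ripxx.
  have -> : s x n * (q n / hnorm (w n)) * hnorm (w n) ^+ 2
      = s x n * (q n * hnorm (w n)).
    by rewrite -mulrA; congr (_ * _); rewrite expr2 mulrA divfK// gt_eqF.
  have p : 0 < q n * hnorm (w n) by rewrite mulr_gt0.
  rewrite /s; case: ifPn => [h|]; first by rewrite mul1r ger0_norm; lra.
  by rewrite -ltNge => h; rewrite mulN1r ler0_norm; lra.
have tail n (k : nat) : hnorm (u (n + k)%N - u n) <= 3 / 2 * (q n - q (n + k)%N).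
  elim: k => [|k IH]; first by rewrite addn0 !subrr hnorm0 mulr0.
  have := hnorm_triangle_sub (u (n + k)%N) (u (n + k.+1)%N) (u n).
  rewrite addnS /= [_ + step _ _]addrC addrK step_norm qS; lra.
have tail' n m : (n <= m)%N -> hnorm (u m - u n) <= 3 / 2 * q n.
  move=> nm; have := tail n (m - n)%N; rewrite subnKC//.
  by have := q0 m; lra.
have q_small e : 0 < e -> exists N, 3 / 2 * q N < e.
  move=> e0; have [|N hN] := @invSn_lt _ (2 / 3 * e); first by lra.
  exists N; have := hN N (leqnn N).
  have : q N <= N.+1%:R^-1.
    rewrite lef_pV2 ?posrE ?exprn_gt0 ?ltr0n//.
    by rewrite -natrX ler_nat ltn_expl.
  by move: (_.+1%:R^-1) => p; lra.
have [x hx] : exists x : H, u @ \oo --> x.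
  apply: cauchy_hnorm_cvg => e /q_small[N hN]; exists N => n Nn.
  by rewrite (le_lt_trans _ hN)// tail'.
have hxn n : hnorm (x - u n) <= 3 / 2 * q n.
  apply/ler_addgt0Pl => e e0.
  have /cvg_hnormP/(_ e e0)[N hN] := hx.
  have := hN _ (leq_maxl N n); have := tail' n _ (leq_maxr N n).
  have := hnorm_triangle_sub (u (maxn N n)) x (u n).
  rewrite (hnorm_sub x (u (maxn N n))); lra.
have [k hk] := wb x.
(* At least half of [q n * |w n|] survives in [|<x, w n>|]; this exceeds [n / 2], hence [|k|]. *)
pose n := Num.bound (2 * `|k|).
have [Wn hn] := hw n.
have h1 := hk _ Wn.
have h2 := step_rip (u n) n.
have h3 := norm_rip_le (x - u n.+1) (w n).
have h4 : rip x (w n) = rip (u n.+1) (w n) + rip (x - u n.+1) (w n).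
  by rewrite -ripDl addrC subrK.
have h5 := ler_normB (rip x (w n)) (rip (x - u n.+1) (w n)).
rewrite {1}h4 addrK in h5.
have h6 : hnorm (x - u n.+1) * hnorm (w n) <= q n / 2 * hnorm (w n).
  by rewrite ler_pM2r// (le_trans (hxn _))// qS; have := q0 n; lra.
have h7 : n%:R < q n * hnorm (w n).
  by rewrite mulrC ltr_pdivlMr ?exprn_gt0.
have h8 : 2 * `|k| < n%:R by apply: archi_boundP; rewrite mulr_ge0.
have := ler_norm k.
rewrite /= in h5 h3 h6; lra.
Qed.

End Operators.

(** * Symmetric operators and orthogonal projections *)

Section Symmetric.
Context {R : realType} {H : hilbert R}.
Implicit Types (x y z : H) (a b e k r : R) (M : set H) (S T : H -> H).

Lemma expr_unbounded r k : 1 < r -> exists n, k < r ^+ n.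
Proof.
move=> r1; have bern n : 1 + n%:R * (r - 1) <= r ^+ n.
  elim: n => [|n IH]; first by rewrite mul0r addr0.
  rewrite exprS -natr1; have : 0 <= n%:R :> R by [].
  have r0 : 0 <= r by lra.
  have := ler_wpM2l r0 IH; move: (n%:R) => m {}IH m0.
  by have := mulr_ge0 m0 (sqr_ge0 (r - 1)); rewrite expr2 => ?; lra.
have r0 : 0 < r - 1 by rewrite subr_gt0.
exists (Num.bound (`|k| / (r - 1))); rewrite (lt_le_trans _ (bern _))//.
have := @archi_boundP _ (`|k| / (r - 1)).
rewrite divr_ge0 ?normr_ge0 ?(ltW r0)// => /(_ isT).
rewrite ltr_pdivrMr// => h; rewrite (le_lt_trans (ler_norm k))//.
by rewrite (lt_trans h)// ltrDr.
Qed.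

(** By symmetry and Cauchy-Schwarz the sequence [b n = |S^n w|] is log-convex, so its ratios do not
    decrease. A first ratio above [r] would persist and outgrow every [k r^n]. *)
Lemma symmetric_iter_le M S w k r : 0 <= r ->
  (forall x, M x -> M (S x)) ->
  (forall x y, M x -> M y -> rip (S x) y = rip x (S y)) -> M w ->
  (forall n, hnorm (iter n S w) <= k * r ^+ n) -> hnorm (S w) <= r * hnorm w.
Proof.
move=> r0 MS sS Mw hk; pose b n := hnorm (iter n S w).
have Mi n : M (iter n S w) by elim: n => //= n; apply: MS.
have b0 n : 0 <= b n by exact: hnorm_ge0.
have logconvex n : b n.+1 ^+ 2 <= b n * b n.+2.
  rewrite /b -ripxx {1}iterS (sS _ _ (Mi n) (Mi n.+1)); exact: rip_le.
rewrite leNgt; apply/negP; rewrite -/(b 0%N) -[hnorm (S w)]/(b 1%N) => rb.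
have b1 : 0 < b 1%N by rewrite (le_lt_trans _ rb)// mulr_ge0.
have pb0 : 0 < b 0%N.
  rewrite lt_neqAle b0 andbT eq_sym; apply/negP => /eqP h.
  have := logconvex 0%N; rewrite h mul0r; have := exprn_gt0 2 b1; lra.
have ratio n : 0 < b n /\ b 1%N * b n <= b n.+1 * b 0%N.
  elim: n => [|n [p h]]; first by [].
  have p1 : 0 < b n.+1 by rewrite -(pmulr_lgt0 _ pb0) (lt_le_trans _ h)// mulr_gt0.
  split=> //; rewrite -(ler_pM2r p).
  have h1 : b n.+1 * (b 1%N * b n) <= b n.+1 * (b n.+1 * b 0%N).
    by rewrite ler_pM2l.
  have h2 : b n.+1 ^+ 2 * b 0%N <= b n * b n.+2 * b 0%N.
    by rewrite ler_pM2r.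
  by rewrite expr2 in h2; nra.
have r1 : 0 < r.
  rewrite lt_neqAle r0 andbT eq_sym; apply/negP => /eqP h.
  by have := hk 1%N; rewrite h expr0n mulr0 /= -[hnorm _]/(b 1%N); lra.
pose s := b 1%N / b 0%N.
have geo n : s ^+ n * b 0%N <= b n.
  elim: n => [|n IH]; first by rewrite expr0 mul1r.
  have [_ h] := ratio n; rewrite exprS -mulrA.
  have s0 : 0 <= s by rewrite divr_ge0.
  rewrite (le_trans (ler_wpM2l s0 IH))// /s mulrAC ler_pdivrMr//.
have [|n hn] := @expr_unbounded (s / r) (k / b 0%N).
  by rewrite ltr_pdivlMr// mul1r /s ltr_pdivlMr.
move: hn; rewrite ltr_pdivrMr// expr_div_n mulrAC ltr_pdivlMr ?exprn_gt0//.
by rewrite ltNge (le_trans (geo n))// hk.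
Qed.

(** An adjoint has no larger norm: [|T x|^2 = <S (T x), x> <= r |T x| |x|]. *)
Lemma adjoint_bound M S T r : 0 <= r -> (forall x, M x -> M (T x)) ->
  (forall x y, M x -> M y -> rip (S x) y = rip x (T y)) ->
  (forall x, M x -> hnorm (S x) <= r * hnorm x) ->
  forall x, M x -> hnorm (T x) <= r * hnorm x.
Proof.
move=> r0 MT adj hS x Mx.
have [->|t0] := eqVneq (T x) 0; first by rewrite hnorm0 mulr_ge0// hnorm_ge0.
have pt : 0 < hnorm (T x) by rewrite hnorm_gt0.
rewrite -(ler_pM2l pt) -expr2 -ripxx -adj//; last exact: MT.
rewrite (le_trans (rip_le _ _))// mulrA ler_wpM2r ?hnorm_ge0//.
by rewrite mulrC hS//; exact: MT.
Qed.

Lemma bounded_op_ext M S T : (forall x, M x -> S x = T x) -> lsubspace M ->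
  bounded_op M S -> bounded_op M T.
Proof.
move=> ST sM [MS lS [k hk]]; split=> [x Mx|c x y Mx My|].
- by rewrite -ST//; exact: MS.
- by rewrite -!ST// ?lS//; case: sM => _; apply.
by exists k => x Mx; rewrite -ST// hk.
Qed.

Section Projection.
Variables (M : set H) (P : H -> H).
Hypotheses (sM : lsubspace M) (oP : orthoproj M P).

Lemma orthoproj_mem x : M x -> M (P x).
Proof. by case: oP => -[+ _ _] _ _; apply. Qed.

Lemma orthoproj_op : bounded_op M P.
Proof. by case: oP. Qed.

Lemma orthoprojK x : M x -> P (P x) = P x.
Proof. by case: oP => _ + _; apply. Qed.

Lemma orthoproj_rip x y : M x -> M y -> rip (P x) y = rip x (P y).
Proof. by move=> Mx My; rewrite /rip; case: oP => _ _ ->. Qed.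

Lemma orthoproj_sqr x : M x -> rip (P x) x = hnorm (P x) ^+ 2.
Proof.
move=> Mx; rewrite -(orthoprojK Mx) orthoproj_rip//; last exact: orthoproj_mem.
by rewrite ripxx orthoprojK.
Qed.

Lemma orthoproj_pyth x : M x ->
  hnorm x ^+ 2 = hnorm (P x) ^+ 2 + hnorm (x - P x) ^+ 2.
Proof. by move=> Mx; rewrite sqr_hnormB (ripC x) orthoproj_sqr//; ring. Qed.

Lemma orthoproj_le x : M x -> hnorm (P x) <= hnorm x.
Proof.
move=> Mx; rewrite ler_sqr_hnorm ?hnorm_ge0// [leRHS]orthoproj_pyth//.
by rewrite lerDl sqr_ge0.
Qed.

Lemma orthoproj0 : P 0 = 0.
Proof. exact: bounded_op0 orthoproj_op. Qed.

Lemma orthoprojD x y : M x -> M y -> P (x + y) = P x + P y.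
Proof. exact: bounded_opD orthoproj_op. Qed.

Lemma orthoprojB x y : M x -> M y -> P (x - y) = P x - P y.
Proof. exact: bounded_opB orthoproj_op. Qed.

Lemma orthoprojC : orthoproj M (fun x => x - P x).
Proof.
split=> [|x Mx|x y Mx My].
- have := bounded_op_lin (-1) sM orthoproj_op (bounded_op_id sM).
  by apply: bounded_op_ext => // x _; rewrite scaleN1r addrC.
- rewrite orthoprojB ?orthoprojK ?subrr ?subr0//; exact: orthoproj_mem.
by rewrite linearBl linearBr /=; case: oP => _ _ ->.
Qed.

End Projection.

Lemma orthoproj_prodC_le M P Q r : orthoproj M P -> orthoproj M Q -> 0 <= r ->
  (forall x, M x -> hnorm (P (Q x)) <= r * hnorm x) ->
  forall x, M x -> hnorm (Q (P x)) <= r * hnorm x.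
Proof.
move=> oP oQ r0; have MP := orthoproj_mem oP; have MQ := orthoproj_mem oQ.
apply: (@adjoint_bound M (P \o Q) (Q \o P)) => // [y My|y z My Mz].
  exact/MQ/MP.
by rewrite /= (orthoproj_rip oP)// ?(orthoproj_rip oQ)//; [exact: MP|exact: MQ].
Qed.

End Symmetric.

(** * The difference of two projections and the norm of their product *)

Section Pair.
Context {R : realType} {H : hilbert R}.
Variables (M : set H) (A P Q : H -> H).
Hypotheses (cM : closed_subspace M) (oP : orthoproj M P) (oQ : orthoproj M Q).
Hypotheses (PQA : forall x, M x -> P x - Q x = A x).
Implicit Types (x y z : H) (r : R).

Let sM : lsubspace M := cM.1.
Let MP := orthoproj_mem oP.
Let MQ := orthoproj_mem oQ.

Lemma pair_diff_op : bounded_op M A.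
Proof.
have := bounded_op_lin (-1) sM (orthoproj_op oQ) (orthoproj_op oP).
by apply: bounded_op_ext => // x Mx; rewrite scaleN1r addrC PQA.
Qed.

Lemma pair_diff_mem x : M x -> M (A x).
Proof. by case: pair_diff_op => + _ _; apply. Qed.

Lemma pair_diff_rip x y : M x -> M y -> rip (A x) y = rip x (A y).
Proof.
by move=> Mx My; rewrite -!PQA// ripBl ripBr !(orthoproj_rip oP, orthoproj_rip oQ).
Qed.

(* Halmos' identity [(P - Q)^2 + (P + Q - 1)^2 = 1], where [P + Q - 1] maps
   [P x] to [Q P x] and [(1 - P) x] to [- (1 - Q) (1 - P) x]. *)
Lemma pair_diff_sqr x : M x ->
  hnorm x ^+ 2 - hnorm (A x) ^+ 2
  = hnorm (Q (P x)) ^+ 2 + hnorm (x - P x - Q (x - P x)) ^+ 2.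
Proof.
move=> Mx; have Mu := MP Mx; have Mv := subspaceB sM Mx Mu.
have -> : hnorm (A x) ^+ 2 = hnorm (P x) ^+ 2 - hnorm (Q (P x)) ^+ 2
    + hnorm (Q (x - P x)) ^+ 2.
  rewrite -PQA// sqr_hnormB.
  have -> : Q x = Q (P x) + Q (x - P x) by rewrite -(orthoprojD oQ)// addrC subrK.
  have -> : rip (P x) (Q (P x) + Q (x - P x))
      = hnorm (Q (P x)) ^+ 2 + rip (Q (P x)) (Q (x - P x)).
    rewrite ripDr (ripC (P x)) (orthoproj_sqr oQ Mu).
    by rewrite (orthoproj_rip oQ Mu (MQ Mv)) (orthoprojK oQ Mv).
  by rewrite sqr_hnormD; ring.
rewrite (orthoproj_pyth oP Mx) (orthoproj_pyth oQ Mv); ring.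
Qed.

Lemma pair_diff_le x : M x -> hnorm (A x) <= hnorm x.
Proof.
move=> Mx; rewrite ler_sqr_hnorm ?hnorm_ge0// -subr_ge0 pair_diff_sqr//.
by rewrite addr_ge0 ?sqr_ge0.
Qed.

Let T x := x - A (A x).

Let T_mem x : M x -> M (T x).
Proof. by move=> Mx; apply: (subspaceB sM) => //; do 2 apply: pair_diff_mem. Qed.

Let T_rip x y : M x -> M y -> rip (T x) y = rip x (T y).
Proof.
by move=> Mx My; rewrite ripBl ripBr !pair_diff_rip//; exact: pair_diff_mem.
Qed.

Let T_diff x : M x -> T (A x) = A (T x).
Proof.
move=> Mx; rewrite /T (bounded_opB sM pair_diff_op)//.
by do 2 apply: pair_diff_mem.
Qed.

Let T_range x : M x -> P x = x -> T x = P (Q x).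
Proof.
move=> Mx Px; rewrite /T -(PQA Mx) Px -PQA; last exact: subspaceB (MQ Mx).
rewrite (orthoprojB sM oP)// ?(orthoprojB sM oQ)//; try exact: MQ.
by rewrite Px (orthoprojK oQ)// subrr subr0 opprB addrC subrK.
Qed.

Let T_ker x : M x -> Q x = 0 -> T x = x - P x + Q (P x).
Proof.
move=> Mx Qx; rewrite /T -(PQA Mx) Qx subr0 -PQA; last exact: MP.
by rewrite (orthoprojK oP)// opprB addrC -addrA [- _ + x]addrC addrC.
Qed.

(* [A] maps [ker Q] into [ran P] and commutes with [T = 1 - A^2], which is [P Q]
   on [ran P].  Hence [|T^n w| <= k r^(2n)] for [w] in [A^2 (ker Q)]; by
   log-convexity of [n |-> |T^n w|] this gives [|T w| <= r^2 |w|], and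
   [A^2 (ker Q)] is dense in [ker Q], where [<T y, y> = |(1 - P) y|^2]. *)
Lemma pair_norm_compl r : (forall x, M x -> A x = 0 -> x = 0) -> 0 <= r ->
  (forall x, M x -> hnorm (P (Q x)) <= r * hnorm x) ->
  forall x, M x -> hnorm (x - Q x - P (x - Q x)) <= r * hnorm x.
Proof.
move=> injA r0 hPQ x Mx.
have hQP := orthoproj_prodC_le oP oQ r0 hPQ.
have T_iter n y : M y -> P y = y -> hnorm (iter n T y) <= (r ^+ 2) ^+ n * hnorm y.
  move=> My Py; suff [] : [/\ M (iter n T y), P (iter n T y) = iter n T y
      & hnorm (iter n T y) <= (r ^+ 2) ^+ n * hnorm y] by [].
  elim: n => [|n [Mn Pn IH]]; first by rewrite expr0 mul1r.
  rewrite iterS T_range//; split; first exact/MP/MQ.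
    by rewrite (orthoprojK oP)//; exact: MQ.
  (* On [ran P] the operator [P Q] is [(P Q) (Q P)]; each of the two factors contributes one [r]. *)
  have -> : P (Q (iter n T y)) = P (Q (Q (P (iter n T y)))).
    by rewrite Pn (orthoprojK oQ).
  rewrite (le_trans (hPQ _ (MQ (MP Mn))))// exprS -mulrA expr2 -mulrA.
  by rewrite ler_wpM2l// (le_trans (hQP _ Mn))// ler_wpM2l.
(* This is [ker Q], written as an orthogonal complement so that its closedness is immediate. *)
pose V := M `&` ortho_compl (Q @` M).
have VP y : V y <-> M y /\ Q y = 0.
  split=> [[My h]|[My Qy]].
    split=> //; apply/eqP; rewrite -hnorm_eq0 -sqrf_eq0 -(orthoproj_sqr oQ)//.
    by rewrite ripC /rip h//=; exists y.
  split=> // _ [z Mz <-]; case: oQ => _ _ h.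
  by rewrite -h// Qy linear0l.
have cV : closed_subspace V := closed_subspaceI cM (ortho_compl_closed _).
have T_V y : V y -> V (T y).
  move=> /VP[My Qy]; apply/VP; split; first exact: T_mem.
  have MPy := MP My; rewrite T_ker// (orthoprojD oQ)//; first last.
  - exact: MQ.
  - exact: subspaceB.
  by rewrite (orthoprojB sM oQ)// Qy (orthoprojK oQ)// sub0r addNr.
pose D := closure ((A \o A) @` V).
have AAV y : V y -> V (A (A y)).
  move=> Vy; have -> : A (A y) = y - T y by rewrite /T opprB addrC subrK.
  exact: (subspaceB cV.1) (T_V _ Vy).
have DP y : D y <-> forall e, 0 < e -> exists2 v, V v & hnorm (A (A v) - y) < e.
  split=> [Dy e e0|h].
    have [|_ [[v Vv <-] yv]] := Dy (ball y e%:C).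
      by apply: nbhsx_ballx; rewrite ltcR.
    exists v => //; move: yv.
    by rewrite -ball_normE /ball_ /= normv_hnorm ltcR hnorm_sub.
  move=> B /nbhs_normP[c /= /gt0c_real[e e0 ->]] hB.
  have [v Vv vy] := h e e0; exists (A (A v)); split; first by exists v.
  by apply: hB => /=; rewrite normv_hnorm ltcR hnorm_sub.
have cD : closed_subspace D.
  split; last exact: closed_closure.
  have [V0 VL] := cV.1; have A0 : A 0 = 0 by exact: bounded_op0 pair_diff_op.
  split; first by apply/DP => e e0; exists 0; rewrite ?A0 ?subrr ?hnorm0.
  move=> c y z /DP hy /DP hz; apply/DP => e e0.
  have c0 : 0 < complex.Re `|c| + 1 by rewrite ltr_wpDl// Re_normc_ge0.
  have [|u Vu yu] := hy (e / (complex.Re `|c| + 1) / 2); first by rewrite !divr_gt0.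
  have [|v Vv zv] := hz (e / 2); first by rewrite divr_gt0.
  exists (c *: u + v); first exact: VL.
  have [Mu _] := Vu; have [Mv _] := Vv; have [_ lA _] := pair_diff_op.
  rewrite !lA//; try exact: pair_diff_mem.
  rewrite opprD addrACA -scalerBr (le_lt_trans (hnorm_triangle _ _))// hnormZc.
  have : complex.Re `|c| * hnorm (A (A u) - y) <= e / 2.
    rewrite mulrAC ltr_pdivlMr// in yu.
    have := hnorm_ge0 (A (A u) - y); lra.
  lra.
have dense y : V y -> D y.
  move=> Vy; have [p Dp hp] := projection_theorem y cD.
  have Vp : V p.
    have /closed_hnormP cV' := cV.2; apply: cV' => e e0.
    by have [v Vv h] := (DP p).1 Dp e e0; exists (A (A v)) => //; exact: AAV.
  have Vq := subspaceB cV.1 Vy Vp; have [Mq _] := Vq.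
  suff /eqP : y - p = 0 by rewrite subr_eq0 => /eqP->.
  (* The vector [q = y - p] of [V] is orthogonal to [A (A q)], which lies in [D]; hence
     [|A q|^2 = <q, A (A q)> = 0]. *)
  apply: injA => //; apply/eqP; rewrite -hnorm_eq0 -sqrf_eq0 -ripxx.
  rewrite pair_diff_rip//; last exact: pair_diff_mem.
  by rewrite /rip hp//; apply: subset_closure; exists (y - p).
have T_AA y : V y -> hnorm (T (A (A y))) <= r ^+ 2 * hnorm (A (A y)).
  move=> /VP[My Qy]; have MAy := pair_diff_mem My.
  (* The constant is [|A y|]: since [T] commutes with [A], the iterate at [A (A y)] is [A] applied
     to the iterate at [A y], where [A y = P y] is in [ran P] and [A] is a contraction. *)
  apply: (@symmetric_iter_le _ _ M _ _ (hnorm (A y))) => //.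
  - by rewrite exprn_ge0.
  - exact: pair_diff_mem.
  move=> n.
  have h : M (iter n T (A y)) /\ iter n T (A (A y)) = A (iter n T (A y)).
    elim: n => [|n [Mn IH]]; first by [].
    by rewrite !iterS IH T_diff//; split=> //; exact: T_mem.
  have [Mn ->] := h; rewrite (le_trans (pair_diff_le Mn))// mulrC T_iter//.
  by rewrite -PQA// Qy subr0 (orthoprojK oP).
have T_V_le y : V y -> hnorm (T y) <= r ^+ 2 * hnorm y.
  move=> Vy; have [My _] := Vy; rewrite -subr_le0.
  (* Replacing [y] by a close [w] costs [2 |w - y|] on the left, as [|T| <= 2], and [r^2 |w - y|] on
     the right. *)
  apply: (@le_mulr_eps _ _ (2 + r ^+ 2)) => [|e e0].
    by rewrite addr_ge0 ?sqr_ge0.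
  have [v Vv hv] := (DP y).1 (dense y Vy) e e0.
  have [Mw _] := AAV _ Vv; set w := A (A v) in hv Mw.
  have h1 := T_AA _ Vv; rewrite -/w in h1.
  have h2 : hnorm (T y) <= hnorm (T w) + 2 * hnorm (w - y).
    rewrite -[T y](subrK (T w)) addrC (le_trans (hnorm_triangle _ _))// lerD2l.
    have MB := subspaceB sM My Mw.
    have -> : T y - T w = T (y - w).
      rewrite /T !(bounded_opB sM pair_diff_op)//; try exact: pair_diff_mem.
      by rewrite !opprB addrACA [in RHS]addrACA; congr (_ + _); rewrite addrC.
    rewrite (le_trans (hnorm_triangleB _ _))// (hnorm_sub w).
    have := pair_diff_le (pair_diff_mem MB); have := pair_diff_le MB; lra.
  have h3 : hnorm w <= hnorm y + hnorm (w - y).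
    by rewrite -{1}[w](subrK y) addrC hnorm_triangle.
  have := sqr_ge0 r; nra.
have Vx : V (x - Q x).
  apply/VP; split; first exact: subspaceB (MQ Mx).
  by rewrite (orthoprojB sM oQ) ?(orthoprojK oQ) ?subrr//; exact: MQ.
have [My _] := Vx; have /VP[_ Qy] := Vx.
have xy : hnorm (x - Q x) <= hnorm x := orthoproj_le (orthoprojC sM oQ) Mx.
move: (x - Q x) Vx My Qy xy => y Vy My Qy xy.
rewrite (le_trans _ (ler_wpM2l r0 xy))//.
rewrite ler_sqr_hnorm ?mulr_ge0 ?hnorm_ge0//.
have -> : hnorm (y - P y) ^+ 2 = rip (T y) y.
  rewrite T_ker// ripDl (orthoproj_rip oQ)//; last exact: MP.
  by rewrite Qy rip0r addr0 (orthoproj_sqr (orthoprojC sM oP)).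
rewrite (le_trans (rip_le _ _))// exprMn expr2 [_ ^+ 2 * _]mulrA.
by rewrite ler_wpM2r ?hnorm_ge0// T_V_le.
Qed.

(** The condition on the right mentions [A] alone, which is the source of all the invariance
    statements. For the converse the identity is evaluated on [ran P], where its second term
    vanishes; this bounds [Q P], and then its adjoint [P Q]. *)
Lemma pair_normP r : (forall x, M x -> A x = 0 -> x = 0) -> 0 <= r ->
  (forall x, M x -> hnorm (P (Q x)) <= r * hnorm x) <->
  (forall x, M x -> hnorm x ^+ 2 - hnorm (A x) ^+ 2 <= r ^+ 2 * hnorm x ^+ 2).
Proof.
move=> injA r0; split=> [hPQ x Mx|h].
  have oP' := orthoprojC sM oP; have oQ' := orthoprojC sM oQ.
  have hQP := orthoproj_prodC_le oP oQ r0 hPQ.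
  have hQP' := orthoproj_prodC_le oP' oQ' r0 (pair_norm_compl injA r0 hPQ).
  rewrite pair_diff_sqr// (orthoproj_pyth oP Mx) mulrDr -!exprMn lerD//.
    have := hQP _ (MP Mx); rewrite (orthoprojK oP Mx) ler_sqr_hnorm//.
    by rewrite mulr_ge0 ?hnorm_ge0.
  have MPx := subspaceB sM Mx (MP Mx).
  have := hQP' _ MPx; rewrite (orthoprojB sM oP Mx (MP Mx)) (orthoprojK oP Mx).
  by rewrite subrr subr0 ler_sqr_hnorm// mulr_ge0 ?hnorm_ge0.
apply: (orthoproj_prodC_le oQ oP r0) => y My.
have MPy := MP My; have := h _ MPy; rewrite pair_diff_sqr// (orthoprojK oP)//.
rewrite subrr (orthoproj0 sM oQ) subrr hnorm0 expr0n addr0 -exprMn.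
rewrite -ler_sqr_hnorm ?mulr_ge0 ?hnorm_ge0// => /le_trans-> //.
by rewrite ler_wpM2l// (orthoproj_le oP).
Qed.

End Pair.

(** * Pairs of projections with a given difference *)

Section PairInvariants.
Context {R : realType} {H : hilbert R}.
Implicit Types (x y z : H) (M : set H) (A P Q : H -> H) (r : R).

Lemma pair_prod_op M A P Q : diff_pairs M A (P, Q) -> bounded_op M (P \o Q).
Proof. by move=> [[bP _ _] [bQ _ _] _]; exact: bounded_op_comp. Qed.

Lemma pair_prod_opnorm_leP M A P Q r : closed_subspace M ->
  (forall x, M x -> A x = 0 -> x = 0) -> diff_pairs M A (P, Q) -> 0 <= r ->
  opnorm M (P \o Q) <= r <->
  (forall x, M x -> hnorm x ^+ 2 - hnorm (A x) ^+ 2 <= r ^+ 2 * hnorm x ^+ 2).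
Proof.
move=> cM injA PQ r0; have [oP oQ PQA] := PQ; have bPQ := pair_prod_op PQ.
rewrite -(pair_normP cM oP oQ PQA injA r0); split=> [h x Mx|h].
  rewrite (le_trans (opnorm_bound cM.1 bPQ Mx))//.
  by rewrite ler_wpM2r ?hnorm_ge0.
by apply: opnorm_le => //; exact: cM.1.
Qed.

Lemma pair_prod_opnorm_invariant M A P Q P' Q' : closed_subspace M ->
  (forall x, M x -> A x = 0 -> x = 0) ->
  diff_pairs M A (P, Q) -> diff_pairs M A (P', Q') ->
  opnorm M (P \o Q) = opnorm M (P' \o Q').
Proof.
move=> cM injA PQ PQ'.
have le := pair_prod_opnorm_leP cM injA.
apply/eqP; rewrite eq_le; apply/andP; split.
  apply/(le _ _ _ PQ); first exact: opnorm_ge0.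
  by apply/(le _ _ _ PQ'); first exact: opnorm_ge0.
apply/(le _ _ _ PQ'); first exact: opnorm_ge0.
by apply/(le _ _ _ PQ); first exact: opnorm_ge0.
Qed.

Lemma pair_sum_opnorm M A P Q : closed_subspace M ->
  (forall x, M x -> A x = 0 -> x = 0) ->
  (forall x, M x -> A (A x) = x -> x = 0) -> (exists2 x, M x & x != 0) ->
  diff_pairs M A (P, Q) ->
  opnorm M (fun x => P x + Q x) = 1 + opnorm M (P \o Q).
Proof.
move=> cM injA injA2 [x0 Mx0 nx0] PQ; have [sM _] := cM.
have [/= oP oQ PQA] := PQ; have bPQ := pair_prod_op PQ.
have MP := orthoproj_mem oP; have MQ := orthoproj_mem oQ.
have bS : bounded_op M (fun x => P x + Q x).
  have := bounded_op_lin 1 sM (orthoproj_op oP) (orthoproj_op oQ).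
  by apply: bounded_op_ext => // x _; rewrite scale1r.
set b := opnorm M (fun x => P x + Q x); set c := opnorm M (P \o Q).
have c0 : 0 <= c := opnorm_ge0 _ _.
(* [|P x + Q x - x|^2 = |x|^2 - |A x|^2] *)
have upper : b <= 1 + c.
  apply: opnorm_le => // [|x Mx]; first by rewrite addr_ge0.
  have hE : hnorm (P x + Q x - x) ^+ 2 = hnorm x ^+ 2 - hnorm (A x) ^+ 2.
    rewrite -PQA// !sqr_hnormB sqr_hnormD ripDl (orthoproj_sqr oP Mx).
    by rewrite (orthoproj_sqr oQ Mx); ring.
  have h := (pair_prod_opnorm_leP cM injA PQ c0).1 (lexx _) x Mx.
  rewrite -[P x + Q x](subrK x) (le_trans (hnorm_triangle _ _))//.
  rewrite mulrDl mul1r addrC lerD2l ler_sqr_hnorm ?mulr_ge0 ?hnorm_ge0//.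
  by rewrite hE exprMn.
(* Test [P + Q] on the sum of the unit vectors along [P Q x] and [Q x]. *)
have lower x : M x -> P (Q x) != 0 ->
    0 <= b - 1 /\ hnorm (P (Q x)) <= (b - 1) * hnorm x.
  move=> Mx PQx; have My := MQ _ Mx; have Mz := MP _ My.
  have Qx : Q x != 0.
    by apply: contraNneq PQx => ->; rewrite (orthoproj0 sM oP).
  have pz : 0 < hnorm (P (Q x)) by rewrite hnorm_gt0.
  have py : 0 < hnorm (Q x) by rewrite hnorm_gt0.
  pose m := (hnorm (P (Q x)))^-1%:C *: P (Q x).
  pose n := (hnorm (Q x))^-1%:C *: Q x.
  pose a := hnorm (P (Q x)) / hnorm (Q x).
  have a0 : 0 < a by rewrite divr_gt0.
  have Mm : M m by exact: subspaceZ.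
  have Mn : M n by exact: subspaceZ.
  have Pm : P m = m.
    by rewrite /m (bounded_opZ _ sM (orthoproj_op oP))// (orthoprojK oP).
  have Qn : Q n = n.
    by rewrite /n (bounded_opZ _ sM (orthoproj_op oQ))// (orthoprojK oQ).
  have m1 : hnorm m = 1 by rewrite hnormZ gtr0_norm ?invr_gt0// mulVf// gt_eqF.
  have n1 : hnorm n = 1 by rewrite hnormZ gtr0_norm ?invr_gt0// mulVf// gt_eqF.
  have mn : rip m n = a.
    rewrite !ripE (orthoproj_sqr oP)// /a; field.
    by rewrite !gt_eqF.
  have Mv : M (m + n) := subspaceD sM Mm Mn.
  have v2 : hnorm (m + n) ^+ 2 = 2 * (1 + a).
    by rewrite sqr_hnormD m1 n1 mn; ring.
  have Pv : 1 + a <= hnorm (P (m + n)).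
    have := rip_le (P (m + n)) m.
    by rewrite (orthoproj_rip oP)// Pm m1 mulr1 ripDl ripxx m1 (ripC n) mn expr1n.
  have Qv : 1 + a <= hnorm (Q (m + n)).
    have := rip_le (Q (m + n)) n.
    by rewrite (orthoproj_rip oQ)// Qn n1 mulr1 ripDl ripxx n1 mn expr1n addrC.
  (* With [v = m + n], [<(P + Q) v, v> = |P v|^2 + |Q v|^2 >= 2 (1 + a)^2], whereas
     [|v|^2 = 2 (1 + a)], [a] being the cosine of the angle between [m] and [n]. *)
  have h : 2 * (1 + a) ^+ 2 <= b * (2 * (1 + a)).
    rewrite -v2 [hnorm (m + n) ^+ 2]expr2 (mulrA b).
    have h1 := opnorm_bound sM bS Mv.
    have h2 : rip (P (m + n) + Q (m + n)) (m + n)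
        <= b * hnorm (m + n) * hnorm (m + n).
      by rewrite (le_trans (rip_le _ _))// ler_wpM2r ?hnorm_ge0.
    rewrite (le_trans _ h2)// ripDl (orthoproj_sqr oP)// (orthoproj_sqr oQ)//.
    have : (1 + a) ^+ 2 <= hnorm (P (m + n)) ^+ 2.
      by rewrite ler_sqr ?nnegrE ?hnorm_ge0//; lra.
    have : (1 + a) ^+ 2 <= hnorm (Q (m + n)) ^+ 2.
      by rewrite ler_sqr ?nnegrE ?hnorm_ge0//; lra.
    lra.
  have ab : 1 + a <= b.
    have p1 : 0 < 2 * (1 + a) by lra.
    by rewrite -(ler_pM2r p1) (le_trans _ h)// expr2; lra.
  split; first by lra.
  have -> : hnorm (P (Q x)) = a * hnorm (Q x) by rewrite /a divfK// gt_eqF.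
  rewrite ler_pM ?hnorm_ge0//; [exact: ltW|by lra|].
  exact: (orthoproj_le oQ Mx).
(* If [P Q] vanished on [M], then [c = 0] and [A] would be isometric; being symmetric it would
   satisfy [A^2 = 1], against [injA2] at [x0]. *)
have [x Mx PQx] : exists2 x, M x & P (Q x) != 0.
  apply: contrapT => nh; have h x : M x -> P (Q x) = 0.
    by move=> Mx; apply: contrapT => /eqP PQx; apply: nh; exists x.
  case/eqP: nx0; apply: injA2 => //.
  have c00 : c <= 0.
    by apply: opnorm_le => // x Mx; rewrite /= h// hnorm0 mul0r.
  have := (pair_prod_opnorm_leP cM injA PQ (lexx 0)).1 c00 x0 Mx0.
  rewrite expr0n mul0r => h1.
  apply/eqP; rewrite -subr_eq0 -hnorm_eq0 -sqrf_eq0 eq_le sqr_ge0 andbT.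
  have MA := pair_diff_mem cM oP oQ PQA Mx0.
  rewrite sqr_hnormB (pair_diff_rip oP oQ PQA)// ripxx.
  have : hnorm (A (A x0)) ^+ 2 <= hnorm (A x0) ^+ 2.
    by rewrite ler_sqr ?nnegrE ?hnorm_ge0// (pair_diff_le cM oP oQ PQA).
  lra.
apply/eqP; rewrite eq_le upper /= addrC -lerBrDr.
have [b1 _] := lower x Mx PQx.
apply: opnorm_le => // y My.
have [->|nz] := eqVneq ((P \o Q) y) 0; last by case: (lower y My nz).
by rewrite hnorm0 mulr_ge0 ?hnorm_ge0.
Qed.

Lemma pair_sum_opnorm_invariant M A P Q P' Q' : closed_subspace M ->
  (forall x, M x -> A x = 0 -> x = 0) ->
  (forall x, M x -> A (A x) = x -> x = 0) ->
  diff_pairs M A (P, Q) -> diff_pairs M A (P', Q') ->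
  opnorm M (fun x => P x + Q x) = opnorm M (fun x => P' x + Q' x).
Proof.
move=> cM injA injA2 PQ PQ'.
have [nt|triv] := pselect (exists2 x, M x & x != 0).
  rewrite (pair_sum_opnorm cM injA injA2 nt PQ).
  rewrite (pair_sum_opnorm cM injA injA2 nt PQ').
  by rewrite (pair_prod_opnorm_invariant cM injA PQ PQ').
apply: opnorm_ext => x Mx; have -> : x = 0.
  by apply: contrapT => /eqP x0; apply: triv; exists x.
have [/= oP oQ _] := PQ; have [/= oP' oQ' _] := PQ'.
rewrite (orthoproj0 cM.1 oP) (orthoproj0 cM.1 oQ).
by rewrite (orthoproj0 cM.1 oP') (orthoproj0 cM.1 oQ').
Qed.

End PairInvariants.

(** * The generic part *)

Section GenericPart.
Context {R : realType} {H : hilbert R}.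
Implicit Types (x y z : H) (A P Q T : H -> H) (r : R).

Lemma nullspace_closed T : bounded_op setT T -> closed_subspace (nullspace T).
Proof.
move=> bT; have sT := (@closed_subspace_setT R H).1; have [_ lT _] := bT.
have [k k0 hk] := bounded_op_bound bT.
split; first split=> [|c x y Tx Ty]; first exact: bounded_op0 bT.
  by rewrite /nullspace /= lT// Tx Ty scaler0 addr0.
apply/closed_hnormP => y h; apply: eq_hnorm0.
apply: (le_mulr_eps (ltW k0)) => e e0.
have [x Tx xy] := h e e0.
have -> : T y = T (y - x) by rewrite (bounded_opB sT bT)// Tx subr0.
by rewrite (le_trans (hk _ I))// mulrC ler_pM2r// hnorm_sub ltW.
Qed.

Lemma generic_space_closed A : closed_subspace (generic_space A).
Proof. exact: ortho_compl_closed. Qed.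

Section Pair.
Variables (A P Q : H -> H).
Hypothesis PQ : diff_pairs setT A (P, Q).

Let cT := @closed_subspace_setT R H.
Let sT := cT.1.
Let oP : orthoproj setT P. Proof. by case: PQ. Qed.
Let oQ : orthoproj setT Q. Proof. by case: PQ. Qed.
Let PQA x : P x - Q x = A x. Proof. by case: PQ => _ _; apply. Qed.
Let bA : bounded_op setT A := pair_diff_op cT oP oQ (fun x _ => PQA x).
Let PD x y : P (x + y) = P x + P y. Proof. exact: (orthoprojD oP I I). Qed.
Let PB x y : P (x - y) = P x - P y. Proof. exact: (orthoprojB sT oP I I). Qed.
Let QB x y : Q (x - y) = Q x - Q y. Proof. exact: (orthoprojB sT oQ I I). Qed.
Let AD x y : A (x + y) = A x + A y. Proof. exact: (bounded_opD bA I I). Qed.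
Let AB x y : A (x - y) = A x - A y. Proof. exact: (bounded_opB sT bA I I). Qed.
Let PP x : P (P x) = P x. Proof. exact: (orthoprojK oP I). Qed.
Let QQ x : Q (Q x) = Q x. Proof. exact: (orthoprojK oQ I). Qed.

Lemma diff_ip x y : ip H (A x) y = ip H x (A y).
Proof.
by rewrite -!PQA linearBl linearBr /=; case: oP => _ _ ->//; case: oQ => _ _ ->.
Qed.

Lemma diff_proj_sqr x : A (A (P x)) = P x - P (Q (P x)).
Proof.
by rewrite -(PQA (P x)) PP -PQA PB QB PP QQ subrr subr0.
Qed.

(** [A^2] commutes with [P], although [A] in general does not. This is why [P] preserves the
    eigenspace of [A^2] for 1 and with it the generic part. *)
Lemma proj_diff_sqr x : P (A (A x)) = A (A (P x)).
Proof.
rewrite diff_proj_sqr -(PQA x) -PQA !(PB, QB) !PP QQ.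
by rewrite opprB addrA subrK.
Qed.

Lemma generic_spaceP x : generic_space A x <->
  (forall y, A y = 0 -> ip H x y = 0) /\ (forall y, A (A y) = y -> ip H x y = 0).
Proof.
have A0 : A 0 = 0 := bounded_op0 sT bA.
split=> [h|[h1 h2] _ [y Ay] [z /= AAz <-]].
  split=> y hy; apply: h.
    by exists y => //; exists 0; rewrite ?addr0// /nullspace /= !A0 subrr.
  by exists 0 => //; exists y; rewrite ?add0r// /nullspace /= hy subrr.
rewrite linearDr /= h1// h2 ?addr0//.
by apply/eqP; rewrite -subr_eq0; apply/eqP.
Qed.

Lemma nullspace_proj x : A x = 0 -> A (P x) = 0.
Proof.
move=> Ax; have PxQx : P x = Q x by apply/eqP; rewrite -subr_eq0 PQA Ax.
by rewrite -PQA PP {2}PxQx QQ PxQx subrr.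
Qed.

Lemma generic_spaceA x : generic_space A x -> generic_space A (A x).
Proof.
move=> /generic_spaceP[h1 h2]; apply/generic_spaceP; split=> y Ay; rewrite diff_ip.
  by rewrite Ay linear0r.
by rewrite h2// Ay.
Qed.

Lemma generic_space_projl x : generic_space A x -> generic_space A (P x).
Proof.
have PC y z : ip H (P y) z = ip H y (P z) by case: oP => _ _ ->.
move=> /generic_spaceP[h1 h2]; apply/generic_spaceP; split=> y Ay; rewrite PC.
  by rewrite h1// nullspace_proj.
by rewrite h2// -proj_diff_sqr Ay.
Qed.

Lemma generic_space_projr x : generic_space A x -> generic_space A (Q x).
Proof.
move=> gx; have -> : Q x = P x - A x by rewrite -PQA opprB addrC subrK.
apply: (subspaceB (generic_space_closed A).1); first exact: generic_space_projl.
exact: generic_spaceA.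
Qed.

Lemma generic_space_pair : diff_pairs (generic_space A) A (P, Q).
Proof.
have restr B : orthoproj setT B ->
    (forall x, generic_space A x -> generic_space A (B x)) ->
    orthoproj (generic_space A) B.
  move=> [[_ lB [k hk]] BB sB] gB; split=> [|x _|x y _ _].
  - by split=> // [c x y _ _|]; [exact: lB|exists k => x _; exact: hk].
  - exact: BB.
  - exact: sB.
split=> [||x _]; last exact: PQA.
- exact: restr generic_space_projl.
- exact: restr generic_space_projr.
Qed.

Lemma generic_space_inj x : generic_space A x -> A x = 0 -> x = 0.
Proof.
move=> /generic_spaceP[h _] /h; rewrite ipxx => -[] /eqP.
by rewrite sqrf_eq0 hnorm_eq0 => /eqP.
Qed.

Lemma generic_space_inj_sqr x : generic_space A x -> A (A x) = x -> x = 0.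
Proof.
move=> /generic_spaceP[_ h] /h; rewrite ipxx => -[] /eqP.
by rewrite sqrf_eq0 hnorm_eq0 => /eqP.
Qed.

Lemma nullspace_ortho x y : A x = 0 -> A (A y) = y -> ip H x y = 0.
Proof. by move=> Ax <-; rewrite -!diff_ip Ax (bounded_op0 sT bA) linear0l. Qed.

(** The two nullspaces are orthogonal, so [x] can be projected on each separately and the remainder
    is orthogonal to both; closedness of their sum never has to be shown. *)
Lemma generic_decomposition x : exists x1 x2 x0,
  [/\ x = x1 + x2 + x0, A x1 = 0, A (A x2) = x2 & generic_space A x0].
Proof.
have bA2 : bounded_op setT (fun z => A (A z) - z).
  have := bounded_op_lin (-1) sT (bounded_op_id sT) (bounded_op_comp bA bA).
  by apply: bounded_op_ext => // z _; rewrite scaleN1r addrC.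
have [x1 Ax1 h1] := projection_theorem x (nullspace_closed bA).
have [x2 /eqP Ax2 h2] := projection_theorem x (nullspace_closed bA2).
rewrite subr_eq0 in Ax2; move/eqP in Ax2.
exists x1, x2, (x - (x1 + x2)); split=> //; first by rewrite addrC subrK.
apply/generic_spaceP; split=> y Ay.
  rewrite opprD addrA linearBl /= h1//.
  by rewrite (ip_sym0 (nullspace_ortho Ay Ax2)) subr0.
rewrite opprD addrCA addrC linearDl /= h2; last by rewrite /nullspace /= Ay subrr.
by rewrite linearNl /= (nullspace_ortho Ax1 Ay) oppr0 addr0.
Qed.

(** The component of [mu] in [ker A] lies in both ranges, so it vanishes by the choice of [mu]. The
    component on which [A^2 = 1] lies in [ran P] and in [ker Q], so it is orthogonal to [ran Q]. *)
Lemma hominus_generic mu : hominus (range P) (range Q) mu ->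
  exists m2 m0, [/\ mu = m2 + m0, P m2 = m2, Q m2 = 0, A (A m2) = m2
    & [/\ generic_space A m0, P m0 = m0 & hnorm m0 <= hnorm mu]].
Proof.
move=> [[v _ Pv] omu]; have Pmu : P mu = mu by rewrite -Pv PP.
have [x1 [x2 [x0 [mE Ax1 Ax2 gx0]]]] := generic_decomposition mu.
have m1E : P x1 = Q x1 by apply/eqP; rewrite -subr_eq0 PQA Ax1.
have AP1 := nullspace_proj Ax1.
have AP2 : A (A (P x2)) = P x2 by rewrite -proj_diff_sqr Ax2.
have gP0 := generic_space_projl gx0.
have muE : mu = P x1 + P x2 + P x0 by rewrite -[LHS]Pmu mE !PD.
have P10 : P x1 = 0.
  have /generic_spaceP[h0 _] := gP0.
  have := omu (P x1); rewrite muE !linearDl /= h0//.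
  rewrite (ip_sym0 (nullspace_ortho AP1 AP2)) !addr0 ipxx.
  have hPQ : (range P `&` range Q) (P x1).
    by split; [exists x1|exists x1; rewrite ?m1E].
  by move=> /(_ hPQ)[] /eqP; rewrite sqrf_eq0 hnorm_eq0 => /eqP.
rewrite P10 add0r in muE.
exists (P x2), (P x0); split=> //.
(* [|Q P x2|^2 = <P Q P x2, P x2>], and [P Q P x2 = P x2 - A^2 P x2 = 0]. *)
- apply/eqP; rewrite -hnorm_eq0 -sqrf_eq0 -(orthoproj_sqr oQ I).
  rewrite -{2}PP -(orthoproj_rip oP I I) -[P (Q _)]opprK.
  have -> : - P (Q (P x2)) = 0; last by rewrite oppr0 rip0l.
  by apply/eqP; rewrite -(inj_eq (addrI (P x2))) -diff_proj_sqr AP2 addr0.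
- split=> //; rewrite ler_sqr_hnorm ?hnorm_ge0// muE sqr_hnormD.
  have /generic_spaceP[_ h0] := gP0.
  by rewrite ripC /rip h0// mulr0 addr0 lerDr sqr_ge0.
Qed.

Lemma closed_range_below : closed (range A) <->
  exists2 d, 0 < d & forall x, generic_space A x -> d * hnorm x <= hnorm (A x).
Proof.
split=> [cR|[d d0 hd]].
  (* The generic part is orthogonal to [ker A], and the orthogonal complement of the closed range
     lies in [ker A]. *)
  have gR x : generic_space A x -> exists z, A z = x.
    move=> /generic_spaceP[gx _].
    have [_ [z _ <-] hz] := projection_theorem x (conj (range_subspace bA) cR).
    exists z; have Aq : A (x - A z) = 0.
      apply/eqP; rewrite -hnorm_eq0 -sqrf_eq0 -ripxx /rip diff_ip hz ?eqxx//.
    have := gx _ Aq; rewrite -{1}(subrK (A z) x) linearDl /= diff_ip Aq linear0r.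
    rewrite addr0 ipxx => -[] /eqP; rewrite sqrf_eq0 hnorm_eq0 subr_eq0.
    by move=> /eqP.
  (* Only the generic component [x0 = A z] of [x] is seen by these [w], and
     [|<A z, w>| = |<z, A w>| <= |z|]. *)
  have [|k hk] := @weakly_bounded R H
      [set w | generic_space A w /\ hnorm (A w) <= 1].
    move=> x; have [x1 [x2 [x0 [-> Ax1 Ax2 gx0]]]] := generic_decomposition x.
    have [z Az] := gR _ gx0; exists (hnorm z) => w [gw Aw].
    have /generic_spaceP[h1 h2] := gw.
    rewrite !ripDl (ripC x1) {1}/rip h1// (ripC x2) {1}/rip h2// !add0r.
    rewrite -Az {1}/rip diff_ip -/(rip z (A w)) (le_trans (norm_rip_le _ _))//.
    by rewrite ler_piMr ?hnorm_ge0.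
  exists (`|k| + 1)^-1 => [|x gx]; first by rewrite invr_gt0 ltr_wpDl.
  rewrite ler_pdivrMl ?ltr_wpDl//.
  have [Ax0|nAx] := eqVneq (A x) 0.
    by rewrite (generic_space_inj gx Ax0) hnorm0 mulr_ge0 ?hnorm_ge0 ?addr_ge0.
  have p : 0 < hnorm (A x) by rewrite hnorm_gt0.
  have := hk ((hnorm (A x))^-1%:C *: x).
  rewrite /= (bounded_opZ _ sT bA)// !hnormZ (gtr0_norm (_ : 0 < _^-1)) ?invr_gt0//.
  have gZ := subspaceZ (hnorm (A x))^-1%:C (generic_space_closed A).1 gx.
  rewrite mulVf ?gt_eqF// => /(_ (conj gZ (lexx 1))).
  rewrite ler_pdivrMl// mulrC => /le_trans-> //.
  rewrite ler_wpM2r ?hnorm_ge0//.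
  by rewrite (le_trans (ler_norm _))// lerDl.
have -> : range A = A @` (ortho_compl (nullspace A)).
  apply/seteqP; split=> _ [x _ <-]; last by exists x.
  have [p Ap hp] := projection_theorem x (nullspace_closed bA).
  by exists (x - p) => //; rewrite AB Ap subr0.
(* On the complement of [ker A], the part with [A^2 = 1] is mapped isometrically, whence the 1, and
   the generic part gives [d^-1]. *)
apply: (closed_image bA (ortho_compl_closed _) (k := 1 + d^-1)) => x ox.
have [x1 [x2 [x0 [xE Ax1 Ax2 gx0]]]] := generic_decomposition x.
have /generic_spaceP[g1 g2] := gx0.
have x10 : x1 = 0.
  have := ox x1 Ax1; rewrite xE !linearDl /= g1//.
  rewrite (ip_sym0 (nullspace_ortho Ax1 Ax2)) !addr0 ipxx => -[] /eqP.
  by rewrite sqrf_eq0 hnorm_eq0 => /eqP.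
rewrite {}x10 add0r in xE.
have n2 : hnorm (A x2) = hnorm x2.
  apply/eqP; rewrite -(@eqrXn2 _ 2)// ?hnorm_ge0// -!ripxx.
  by rewrite /rip diff_ip Ax2.
have hAx : hnorm (A x) ^+ 2 = hnorm (A x2) ^+ 2 + hnorm (A x0) ^+ 2.
  rewrite xE AD sqr_hnormD /rip -diff_ip Ax2 -/(rip x2 x0) ripC /rip g2//.
  by rewrite mulr0 addr0.
have h2 : hnorm x2 <= hnorm (A x).
  by rewrite -n2 ler_sqr_hnorm ?hnorm_ge0// hAx lerDl sqr_ge0.
have h0 : hnorm x0 <= d^-1 * hnorm (A x).
  rewrite ler_pdivlMl// (le_trans (hd _ gx0))//.
  by rewrite ler_sqr_hnorm ?hnorm_ge0// hAx lerDr sqr_ge0.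
by rewrite {1}xE (le_trans (hnorm_triangle _ _))// mulrDl mul1r lerD.
Qed.

Lemma closed_range_norm :
  closed (range A) <-> opnorm (generic_space A) (P \o Q) < 1.
Proof.
have cM := generic_space_closed A; have gPQ := generic_space_pair.
have le := pair_prod_opnorm_leP cM generic_space_inj gPQ.
rewrite closed_range_below; split=> [[d d0 hd]|].
  (* The truncation keeps [1 - d1^2] nonnegative; when the generic part is zero, [d] can be
     arbitrarily large. *)
  pose d1 := Num.min d 1.
  have d10 : 0 < d1 by rewrite lt_min d0 ltr01.
  have d11 : d1 <= 1 by rewrite ge_min lexx orbT.
  have r0 : 0 <= 1 - d1 ^+ 2 by rewrite subr_ge0 expr_le1// ltW.
  apply: (@le_lt_trans _ _ (Num.sqrt (1 - d1 ^+ 2))); last first.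
    by rewrite -[ltRHS]sqrtr1 ltr_sqrt// ltrBlDr ltrDl exprn_gt0.
  apply/le; first exact: sqrtr_ge0.
  move=> x gx; rewrite sqr_sqrtr// mulrBl mul1r lerD2l lerN2 -exprMn.
  rewrite ler_sqr ?nnegrE ?mulr_ge0 ?hnorm_ge0 ?(ltW d10)//.
  by rewrite (le_trans _ (hd _ gx))// ler_wpM2r ?hnorm_ge0// ge_min lexx.
set c := opnorm _ _ => c1; have c0 : 0 <= c := opnorm_ge0 _ _.
have dc : 0 < 1 - c ^+ 2 by rewrite subr_gt0 expr_lt1.
(* [|A x|^2 >= (1 - c^2) |x|^2], and [1 - c^2] dominates its own square, which avoids a square
   root. *)
exists (1 - c ^+ 2) => // x gx.
have := (le c c0).1 (lexx _) x gx; rewrite lerBlDr -lerBlDl => h.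
rewrite -ler_sqr ?nnegrE ?mulr_ge0 ?hnorm_ge0 ?(ltW dc)// exprMn (le_trans _ h)//.
rewrite -[X in _ <= X - _]mul1r -mulrBl ler_wpM2r ?sqr_ge0//.
by rewrite expr2 ler_piMl ?(ltW dc)// gerBl sqr_ge0.
Qed.

End Pair.

(** Exchanging the projections negates [A] and keeps the generic part, so what is proved for vectors
    of [ran P] applies to those of [ran Q]. *)
Lemma diff_pairsN A P Q : diff_pairs setT A (P, Q) ->
  diff_pairs setT (fun x => - A x) (Q, P).
Proof. by move=> [/= oP oQ h]; split=> //= x _; rewrite -h// opprB. Qed.

Lemma generic_spaceN A P Q : diff_pairs setT A (P, Q) ->
  generic_space (fun x => - A x) = generic_space A.
Proof.
move=> PQ; have QP := diff_pairsN PQ; have [/= oP oQ PQA] := PQ.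
have cT := @closed_subspace_setT R H.
have bA : bounded_op setT A := pair_diff_op cT oP oQ PQA.
have AN x : A (- A x) = - A (A x) by rewrite (bounded_opN cT.1 bA).
apply/seteqP; split=> x.
  move=> /(generic_spaceP QP)[h1 h2]; apply/(generic_spaceP PQ).
  split=> y Ay; first by rewrite h1// Ay oppr0.
  by rewrite h2// AN opprK.
move=> /(generic_spaceP PQ)[h1 h2]; apply/(generic_spaceP QP).
split=> y Ay; first by rewrite h1//; apply/eqP; rewrite -oppr_eq0 Ay.
by rewrite h2// -[RHS]Ay AN opprK.
Qed.

Lemma friedrichs_cos_generic A P Q : diff_pairs setT A (P, Q) ->
  friedrichs_cos (range P) (range Q) = opnorm (generic_space A) (P \o Q).
Proof.
move=> PQ; have [/= oP oQ PQA] := PQ.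
rewrite /friedrichs_cos; set E := (X in sup X).
have gPQ := generic_space_pair PQ; have [/= goP goQ _] := gPQ.
have cG := generic_space_closed A.
have ub r : E r -> r <= opnorm (generic_space A) (P \o Q).
  move=> [mu [nu [hmu hnu mu1 nu1 ->]]].
  have [m2 [m0 [muE Pm2 Qm2 Am2 [gm0 Pm0 m0l]]]] := hominus_generic PQ hmu.
  have [n2 [n0 [nuE Qn2 Pn2 An2 [gn0 Qn0 n0l]]]] :=
    hominus_generic (diff_pairsN PQ) hnu.
  rewrite (generic_spaceN PQ) in gn0.
  have An2' : A (A n2) = n2.
    have cT := @closed_subspace_setT R H.
    have bA : bounded_op setT A := pair_diff_op cT oP oQ PQA.
    by rewrite -[RHS]An2 (bounded_opN cT.1 bA)// opprK.
  (* The generic components are orthogonal to [m2] and [n2], and [<m2, n2> = <m2, P n2> = 0]. *)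
  have -> : ip H mu nu = ip H m0 n0.
    have /(generic_spaceP PQ)[_ gm] := gm0; have /(generic_spaceP PQ)[_ gn] := gn0.
    rewrite muE nuE !linearDl /= !linearDr /= gm// (ip_sym0 (gn _ Am2)) addr0 add0r.
    rewrite -Pm2; case: oP => _ _ ->//.
    by rewrite Pn2 linear0r add0r.
  have -> : ip H m0 n0 = ip H m0 (P (Q n0)).
    by rewrite Qn0 -{1}Pm0; case: oP => _ _ ->.
  rewrite (le_trans (norm_ip_le _ _))// mulrC.
  rewrite (le_trans (ler_wpM2l (hnorm_ge0 _) m0l))// mu1 mulr1.
  rewrite (le_trans (opnorm_bound cG.1 (pair_prod_op gPQ) gn0))//.
  by rewrite ler_piMr ?opnorm_ge0// (le_trans n0l) ?nu1.
have E0 r : E r -> 0 <= r by move=> [mu [nu [_ _ _ _ ->]]]; exact: Re_normc_ge0.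
have hE : has_ubound E by exists (opnorm (generic_space A) (P \o Q)).
(* [E] can be empty, and then its [sup] is 0 by default. *)
have sE0 : 0 <= sup E.
  have [[r Er]|nE] := pselect (E !=set0).
    by rewrite (le_trans (E0 _ Er))//; exact: ub_le_sup.
  by rewrite sup_out// => -[].
apply/eqP; rewrite eq_le; apply/andP; split.
  have [nE|nE] := pselect (E !=set0); first exact: ge_sup.
  by rewrite sup_out ?opnorm_ge0// => -[].
apply: opnorm_le => // [|x gx]; first exact: cG.1.
have gy := generic_space_projr PQ gx; have gz := generic_space_projl PQ gy.
rewrite /= (le_trans _ (ler_wpM2l sE0 (orthoproj_le oQ I)))//.
have [->|z0] := eqVneq (P (Q x)) 0; first by rewrite hnorm0 mulr_ge0 ?hnorm_ge0.
have y0 : Q x != 0.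
  by apply: contraNneq z0 => ->; rewrite (orthoproj0 cG.1 goP).
have pz : 0 < hnorm (P (Q x)) by rewrite hnorm_gt0.
have py : 0 < hnorm (Q x) by rewrite hnorm_gt0.
pose m := (hnorm (P (Q x)))^-1%:C *: P (Q x).
pose n := (hnorm (Q x))^-1%:C *: Q x.
have gm : generic_space A m by exact: (subspaceZ _ cG.1 gz).
have gn : generic_space A n by exact: (subspaceZ _ cG.1 gy).
have m1 : hnorm m = 1 by rewrite hnormZ gtr0_norm ?invr_gt0// mulVf// gt_eqF.
have n1 : hnorm n = 1 by rewrite hnormZ gtr0_norm ?invr_gt0// mulVf// gt_eqF.
(* A common vector of the ranges is in [ker A], hence orthogonal to [m] and [n]; so these are
   admissible in the supremum. *)
have common v : (range P `&` range Q) v -> A v = 0.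
  move=> [[u _ <-] [w _ wu]]; rewrite -PQA// (orthoprojK oP)//.
  by rewrite -wu (orthoprojK oQ)// subrr.
have Em : E (complex.Re `|ip H m n|).
  exists m, n; split=> //; split.
  - exists m => //.
    by rewrite (bounded_opZ _ cG.1 (orthoproj_op goP) gz) (orthoprojK oP).
  - by move=> v /common; have /(generic_spaceP PQ)[h _] := gm; exact: h.
  - exists n => //.
    by rewrite (bounded_opZ _ cG.1 (orthoproj_op goQ) gy) (orthoprojK oQ).
  - move=> v; rewrite setIC => /common.
    by have /(generic_spaceP PQ)[h _] := gn; exact: h.
have h1 : rip m n = hnorm (P (Q x)) / hnorm (Q x).
  by rewrite !ripE (orthoproj_sqr oP)//; field; rewrite !gt_eqF.
rewrite -ler_pdivrMr// -h1 (le_trans (ler_norm _))//.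
by rewrite (le_trans (rip_le_norm_ip _ _))//; exact: ub_le_sup.
Qed.

Lemma friedrichs_cos_invariant A P Q P' Q' :
  diff_pairs setT A (P, Q) -> diff_pairs setT A (P', Q') ->
  friedrichs_cos (range P) (range Q) = friedrichs_cos (range P') (range Q').
Proof.
move=> PQ PQ'; rewrite (friedrichs_cos_generic PQ) (friedrichs_cos_generic PQ').
apply: (pair_prod_opnorm_invariant (generic_space_closed A)
  (generic_space_inj PQ)); exact: generic_space_pair.
Qed.

End GenericPart.

(** * Functional calculus *)

Section PolynomialCalculus.
Context {R : realType} {L : hilbert R}.
Variable T : L -> L.
Hypothesis bT : bounded_op setT T.
Implicit Types (x y : L) (p q : {poly R[i]}) (d b e k : R).

Let cT := @closed_subspace_setT R L.
Let sT := cT.1.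

Definition opoly p x := \sum_(i < size p) p`_i *: iter i T x.

Lemma iter_op n : bounded_op setT (iter n T).
Proof.
elim: n => [|n IH]; first exact: bounded_op_id.
exact: bounded_op_comp bT IH.
Qed.

Lemma opoly_widen n p x : (size p <= n)%N ->
  opoly p x = \sum_(i < n) p`_i *: iter i T x.
Proof.
move=> pn; rewrite /opoly (big_ord_widen n (fun i => p`_i *: iter i T x) pn).
rewrite [RHS](bigID (fun i : 'I_n => (i < size p)%N)) /= [X in _ + X]big1 ?addr0//.
by move=> i; rewrite -leqNgt => /(nth_default 0)->; rewrite scale0r.
Qed.

Lemma opolyD p q x : opoly (p + q) x = opoly p x + opoly q x.
Proof.
pose n := maxn (size p) (size q).
rewrite (@opoly_widen n (p + q)) ?size_polyD//.
rewrite (@opoly_widen n p) ?leq_maxl// (@opoly_widen n q) ?leq_maxr//.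
by rewrite -big_split; apply: eq_bigr => i _; rewrite coefD scalerDl.
Qed.

Lemma opolyZXn c n x : opoly (c *: 'X^n) x = c *: iter n T x.
Proof.
rewrite (@opoly_widen n.+1); last first.
  by rewrite (leq_trans (size_scale_leq _ _))// size_polyXn.
rewrite (bigD1 ord_max)//= big1 ?addr0 => [|i].
  by rewrite coefZ coefXn eqxx mulr1.
rewrite -val_eqE /= => ni; rewrite coefZ coefXn (negbTE ni) mulr0.
by rewrite scale0r.
Qed.

Lemma opolyC c x : opoly c%:P x = c *: x.
Proof. by have := opolyZXn c 0 x; rewrite expr0 alg_polyC. Qed.

Lemma opolyXsubCM z p x :
  opoly (('X - z%:P) * p) x = opoly p (T x - z *: x).
Proof.
have -> : opoly p (T x - z *: x)
    = \sum_(i < size p) p`_i *: iter i.+1 T x - z *: opoly p x.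
  rewrite /opoly scaler_sumr -sumrB; apply: eq_bigr => i _.
  rewrite (bounded_opB sT (iter_op i))// (bounded_opZ _ sT (iter_op i))//.
  by rewrite -iterSr scalerBr !scalerA [z * _]mulrC.
rewrite (@opoly_widen (size p).+1); last first.
  rewrite (leq_trans (size_polyMleq _ _))// size_XsubC.
  by rewrite addSn.
rewrite (@opoly_widen (size p).+1 p)// scaler_sumr.
have -> : \sum_(i < size p) p`_i *: iter i.+1 T x
    = \sum_(i < (size p).+1) ('X * p)`_i *: iter i T x.
  rewrite big_ord_recl coefXM /= scale0r add0r.
  by apply: eq_bigr => i _; rewrite coefXM.
rewrite -sumrB; apply: eq_bigr => i _.
by rewrite mulrBl coefB coefCM scalerBl scalerA.
Qed.

Section Bounds.
Variables d b : R.
Hypotheses (realT : forall x, complex.Im (ip L (T x) x) = 0).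
Hypotheses (geT : forall x, d * hnorm x ^+ 2 <= rip (T x) x).
Hypotheses (leT : forall x, rip (T x) x <= b * hnorm x ^+ 2).

(** For unit [x] the number [<T x, x>] lies in the real interval [[d, b]], so [<(T - l) x, x>] is at
    least as large as the distance of [l] from that interval: above or below the real axis, left of
    [d], or right of [b]. *)
Lemma shift_coercive l : ~ (complex.Im l = 0 /\ d <= complex.Re l <= b) ->
  exists2 e, 0 < e &
    forall x, e * hnorm x ^+ 2 <= complex.Re `|ip L (T x - l *: x) x|.
Proof.
move=> hl.
have shiftE x : ip L (T x - l *: x) x
    = (rip (T x) x - complex.Re l * hnorm x ^+ 2)
      +i* (- (complex.Im l * hnorm x ^+ 2)).
  rewrite linearBl linearZl_LR /= ipxx; apply/eqP; rewrite eq_complex.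
  rewrite /rip; move: (realT x); case: (ip L (T x) x) => u v /= ->.
  by case: (l) => s t /=; apply/andP; split; apply/eqP; ring.
have Imle (u : R[i]) : `|complex.Im u| <= complex.Re `|u|.
  by rewrite normc_def /= -sqrtr_sqr ler_wsqrtr// lerDr sqr_ge0.
have [l0|l0] := eqVneq (complex.Im l) 0; last first.
  exists `|complex.Im l| => [|x]; first by rewrite normr_gt0.
  rewrite (le_trans _ (Imle _))// shiftE /= normrN normrM.
  by rewrite (ger0_norm (sqr_ge0 (hnorm x))).
have [ld|dl] := ltP (complex.Re l) d.
  exists (d - complex.Re l) => [|x]; first by rewrite subr_gt0.
  rewrite (le_trans _ (Re_normc_geRe _))// (le_trans _ (ler_norm _))//.
  by rewrite shiftE /= mulrBl lerD2r.
have [lb|bl] := ltP b (complex.Re l).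
  exists (complex.Re l - b) => [|x]; first by rewrite subr_gt0.
  rewrite (le_trans _ (Re_normc_geRe _))// -normrN (le_trans _ (ler_norm _))//.
  by rewrite shiftE /= opprB mulrBl lerD2l lerN2.
by case: hl; rewrite l0 dl bl.
Qed.

Lemma spectrum_bounds l :
  spectrum T l -> complex.Im l = 0 /\ d <= complex.Re l <= b.
Proof.
move=> sl; apply: contrapT => /shift_coercive[e e0 he]; apply: sl.
apply: lax_milgram e0 he.
have := bounded_op_lin (- l) sT (bounded_op_id sT) bT.
by apply: bounded_op_ext => // x _; rewrite scaleNr addrC.
Qed.

Lemma opoly_below p : p != 0 ->
  (forall l, root p l -> ~ (complex.Im l = 0 /\ d <= complex.Re l <= b)) ->
  exists2 e, 0 < e & forall x, e * hnorm x <= hnorm (opoly p x).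
Proof.
have [rs ->] := closed_field_poly_normal p.
have [->|c0 _] := eqVneq (lead_coef p) 0; first by rewrite scale0r eqxx.
move: (lead_coef p) c0 => c c0.
elim: rs => [|z rs IH] hr.
  rewrite big_nil; exists (complex.Re `|c|).
    by rewrite -ltcR -normc_Re normr_gt0.
  by move=> x; rewrite alg_polyC opolyC hnormZc.
have [|e e0 he] := IH.
  move=> l rl; apply: hr; rewrite big_cons scalerAr rootM rl orbT //.
have [|f f0 hf] := @shift_coercive z.
  by apply: hr; rewrite big_cons scalerAr rootM root_XsubC eqxx.
exists (e * f) => [|x]; first exact: mulr_gt0.
rewrite big_cons scalerAr opolyXsubCM -mulrA (le_trans _ (he _))//.
by rewrite ler_pM2l// (@coercive_below _ _ (fun x => T x - z *: x)).
Qed.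

Definition cpoly (q : {poly R}) : {poly R[i]} := map_poly (real_complex R) q.

Lemma opoly_real_rip (q : {poly R}) x y :
  (forall x y, rip (T x) y = rip x (T y)) ->
  rip (opoly (cpoly q) x) y = rip x (opoly (cpoly q) y).
Proof.
move=> sym; have symi n u v : rip (iter n T u) v = rip u (iter n T v).
  by elim: n u v => [//|n IH] u v; rewrite iterS sym IH -iterSr.
rewrite /opoly; have ripl I (r : seq I) (F : I -> L) v :
    rip (\sum_(i <- r) F i) v = \sum_(i <- r) rip (F i) v.
  by elim/big_ind2: _ => [|? ? ? ? <- <-|//]; rewrite ?rip0l ?ripDl.
rewrite [RHS]ripC !ripl; apply: eq_bigr => i _.
by rewrite coef_map /= !ripZl [in RHS]ripC symi.
Qed.

End Bounds.

End PolynomialCalculus.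

(** * Norms of symmetric operators and of their real polynomials *)

Section SymmetricNorm.
Context {R : realType} {L : hilbert R}.
Variable S : L -> L.
Hypothesis bS : bounded_op setT S.
Hypothesis symS : forall x y, rip (S x) y = rip x (S y).
Implicit Types (x y : L) (k : R).

(* With [k] the norm of [S], [|(S^2 - k^2) x|^2 <= k^2 (k^2 |x|^2 - |S x|^2)],
   so [S - k] and [S + k] are not both bounded below. *)
Lemma symmetric_norm_le k : 0 <= k ->
  (forall l, k < `|l| -> exists2 e, 0 < e &
     forall x, e * hnorm x <= hnorm (S x - l%:C *: x)) ->
  forall x, hnorm (S x) <= k * hnorm x.
Proof.
move=> k0 below; have sT := (@closed_subspace_setT R L).1.
suff nk : opnorm setT S <= k.
  move=> x; rewrite (le_trans (opnorm_bound sT bS I))//.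
  by rewrite ler_wpM2r ?hnorm_ge0.
rewrite leNgt; apply/negP; set n := opnorm setT S => kn.
have n0 : 0 < n by exact: le_lt_trans kn.
have [|e e0 he] := below n; first by rewrite gtr0_norm.
have [|f f0 hf] := below (- n); first by rewrite normrN gtr0_norm.
have gap x : (e * f) ^+ 2 * hnorm x ^+ 2
    <= n ^+ 2 * (n ^+ 2 * hnorm x ^+ 2 - hnorm (S x) ^+ 2).
  pose y := S x - (- n)%:C *: x.
  have yE : S y - n%:C *: y = S (S x) - (n ^+ 2)%:C *: x.
    rewrite /y (bounded_opB sT bS)// (bounded_opZ _ sT bS)// scalerBr scalerA.
    rewrite -rmorphM /= mulrN -expr2 !rmorphN /= !scaleNr !opprK opprD.
    by rewrite addrA addrK.
  have h1 : e * f * hnorm x <= hnorm (S (S x) - (n ^+ 2)%:C *: x).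
    by rewrite -yE (le_trans _ (he _))// -mulrA ler_pM2l// hf.
  have h2 : hnorm (S (S x)) ^+ 2 <= n ^+ 2 * hnorm (S x) ^+ 2.
    rewrite -exprMn -ler_sqr_hnorm ?mulr_ge0 ?hnorm_ge0 ?(ltW n0)//.
    exact: opnorm_bound.
  have h3 : (e * f * hnorm x) ^+ 2 <= hnorm (S (S x) - (n ^+ 2)%:C *: x) ^+ 2.
    by rewrite ler_sqr ?nnegrE ?mulr_ge0 ?hnorm_ge0 ?(ltW e0) ?(ltW f0).
  rewrite -exprMn (le_trans h3)// sqr_hnormB ripZr symS ripxx hnormZ.
  rewrite exprMn (ger0_norm (sqr_ge0 n)); nra.
(* Chosen so that [n g <= e f] and [g <= n]; the gap then gives [|S x|^2 <= (n^2 - g^2) |x|^2],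
   against [n] being the norm. *)
pose g := Num.min (e * f / n) n.
have g0 : 0 < g by rewrite lt_min n0 divr_gt0// mulr_gt0.
have gn : g ^+ 2 <= n ^+ 2.
  by rewrite ler_sqr ?nnegrE ?(ltW g0) ?(ltW n0)// ge_min lexx orbT.
have gef : n ^+ 2 * g ^+ 2 <= (e * f) ^+ 2.
  rewrite -exprMn ler_sqr ?nnegrE ?mulr_ge0 ?(ltW g0) ?(ltW n0) ?(ltW e0) ?(ltW f0)//.
  by rewrite mulrC -ler_pdivlMr// ge_min lexx.
have : n <= Num.sqrt (n ^+ 2 - g ^+ 2).
  apply: opnorm_le => // x _.
  rewrite ler_sqr_hnorm ?mulr_ge0 ?hnorm_ge0 ?sqrtr_ge0// exprMn sqr_sqrtr ?subr_ge0//.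
  have n20 : 0 < n ^+ 2 by rewrite exprn_gt0.
  rewrite -(ler_pM2l n20); have := gap x.
  have := ler_wpM2r (sqr_ge0 (hnorm x)) gef; lra.
rewrite -ler_sqr ?nnegrE ?sqrtr_ge0 ?(ltW n0)// sqr_sqrtr ?subr_ge0//.
by have := exprn_gt0 2 g0; lra.
Qed.

End SymmetricNorm.

Section PolynomialNorm.
Context {R : realType} {L : hilbert R}.
Variables (T : L -> L) (d b : R).
Hypothesis bT : bounded_op setT T.
Hypothesis symT : forall x y, rip (T x) y = rip x (T y).
Hypotheses (realT : forall x, complex.Im (ip L (T x) x) = 0).
Hypotheses (geT : forall x, d * hnorm x ^+ 2 <= rip (T x) x).
Hypotheses (leT : forall x, rip (T x) x <= b * hnorm x ^+ 2).

Lemma opoly_op p : bounded_op setT (opoly T p).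
Proof.
have sT := (@closed_subspace_setT R L).1.
rewrite /opoly.
pose F n := fun x : L => \sum_(i < n) p`_i *: iter i T x.
suff h n : bounded_op setT (F n) by exact: (h (size p)).
elim: n => [|n IH].
  split=> // [c x y _ _|]; first by rewrite /F !big_ord0 scaler0 addr0.
  by exists 0 => x _; rewrite /F big_ord0 hnorm0 mul0r.
have := bounded_op_lin p`_n sT (iter_op bT n) IH.
by apply: bounded_op_ext => // x _; rewrite /F big_ord_recr /= addrC.
Qed.

Lemma opoly_norm_le (q : {poly R}) k : 0 <= k ->
  (forall t, d <= t <= b -> `|q.[t]| <= k) ->
  forall x, hnorm (opoly T (cpoly q) x) <= k * hnorm x.
Proof.
move=> k0 hq; apply: symmetric_norm_le => //; first exact: opoly_op.
  by move=> x y; exact: opoly_real_rip.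
move=> l kl.
have qlE x : opoly T (cpoly q) x - l%:C *: x = opoly T (cpoly (q - l%:P)) x.
  by rewrite /cpoly rmorphB /= map_polyC /= opolyD -polyCN opolyC scaleNr.
(* A constant [q] leaves nothing to factor. If [[d, b]] is nonempty, then [|l| <= k], which is
   excluded; if [b < d], the two bounds on the form force the space to be 0. *)
have [ql0|ql0] := eqVneq (q - l%:P) 0.
  have [/hq|nd] := boolP (d <= d <= b).
    have -> : q.[d] = l.
      by rewrite -[q](subrK l%:P) ql0 add0r hornerC.
    by rewrite leNgt kl.
  exists 1 => // x; rewrite mul1r.
  suff -> : x = 0 by rewrite hnorm0 hnorm_ge0.
  apply/eqP; rewrite -hnorm_eq0 -sqrf_eq0 eq_le sqr_ge0 andbT.
  have := le_trans (geT x) (leT x).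
  rewrite lexx /= -ltNge in nd; have := sqr_ge0 (hnorm x); nra.
have [||e e0 he] := @opoly_below _ _ T bT d b realT geT leT (cpoly (q - l%:P)).
- by rewrite map_poly_eq0.
- move=> z rz [z0 /hq hz].
  have zE : z = (complex.Re z)%:C by case: z z0 {rz hz} => u v /= ->.
  move: rz; rewrite zE /root horner_map /= fmorph_eq0 hornerD hornerN hornerC.
  by rewrite subr_eq0 => /eqP hh; move: hz; rewrite hh leNgt kl.
by exists e => // x; rewrite qlE.
Qed.

End PolynomialNorm.

(** * Uniform convergence of the Taylor polynomials of the cosine *)

Section CosineSeries.
Context {R : realType}.
Implicit Types (s t e k : R) (n : nat).

Definition ccoef n : R := (-1) ^+ n / (n.*2)`!%:R.

Definition cospoly n : {poly R} := \sum_(i < n) ccoef i *: 'X^(i.*2).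

Lemma le_cos s t : 0 <= s -> s <= t -> t <= pi -> cos t <= cos s.
Proof.
move=> s0 st tpi; have [->//|nt] := eqVneq s t; apply/ltW.
have sI : s \in `[0, pi] by rewrite in_itv /= s0 (le_trans st).
have tI : t \in `[0, pi] by rewrite in_itv /= tpi (le_trans s0).
by rewrite (ltr_cos sI tI) lt_neqAle nt.
Qed.

Lemma norm_ccoef n : `|ccoef n| = (n.*2)`!%:R^-1.
Proof. by rewrite normrM normrX normrN1 expr1n mul1r ger0_norm ?invr_ge0. Qed.

Lemma cospolyE n t : (cospoly n).[t] = series (cos_coeff' t) n.
Proof.
rewrite /cospoly horner_sum seriesEord /=; apply: eq_bigr => i _.
by rewrite hornerZ hornerXn mulrAC.
Qed.

Lemma series_exp_le k n : 0 <= k -> series (exp_coeff k) n <= expR k.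
Proof.
move=> k0; apply: nondecreasing_cvgn_le; last exact: is_cvg_series_exp_coeff.
by apply: nondecreasing_series => i _ _; exact: exp_coeff_ge0.
Qed.

(** A tail of the series of [cosh k], dominated by that of [exp k]. It is the common majorant for
    the cosine of numbers with [|t| <= k] and of operators bounded by [k]. *)
Lemma even_exp_tail k e : 0 <= k -> 0 < e ->
  exists N, forall m n, (N <= m)%N -> (m <= n)%N ->
    \sum_(m <= i < n) k ^+ i.*2 / (i.*2)`!%:R <= e.
Proof.
move=> k0 e0; pose u i : R := k ^+ i.*2 / (i.*2)`!%:R.
have u0 i : 0 <= u i by rewrite divr_ge0// exprn_ge0.
have ule n : series u n <= series (exp_coeff k) n.*2.
  elim: n => [|n IH]; first by rewrite !seriesEnat /= !big_geq.
  rewrite doubleS !seriesSr -addrA lerD// lerDl; exact: exp_coeff_ge0.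
have cu : cvgn (series u).
  apply: nondecreasing_is_cvgn; first by apply: nondecreasing_series => i _ _.
  by exists (expR k) => _ [n _ <-]; rewrite (le_trans (ule n))// series_exp_le.
have /cvgrPdist_lt/(_ e e0)[N _ hN] := cu.
exists N => m n Nm mn; rewrite -(sub_series_geq u mn).
have h : series u n <= limn (series u).
  by apply: nondecreasing_cvgn_le => //; apply: nondecreasing_series => i _ _.
have := hN m Nm => /= /ltW; apply: le_trans.
by rewrite (le_trans _ (ler_norm _))// lerD2r.
Qed.

Lemma cospoly_uniform k e : 0 <= k -> 0 < e ->
  exists N, forall n, (N <= n)%N ->
    forall t, `|t| <= k -> `|(cospoly n).[t] - cos t| <= e.
Proof.
move=> k0 e0; have e20 : 0 < e / 2 by rewrite divr_gt0.
have [N hN] := even_exp_tail k0 e20.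
(* [M] depends on [t], but it only serves to get near [cos t]; [N] comes from the majorant and is
   uniform. *)
exists N => n Nn t tk; have /cvgrPdist_lt/(_ _ e20)[M _ hM] := @cvg_cos_coeff' R t.
have := hM _ (leq_maxl M n); have := hN n _ Nn (leq_maxr M n).
move: (maxn M n) (leq_maxr M n) => m nm hs /= hm.
have : `|series (cos_coeff' t) m - series (cos_coeff' t) n| <= e / 2.
  rewrite (sub_series_geq _ nm) (le_trans (ler_norm_sum _ _ _))// (le_trans _ hs)//.
  apply: ler_sum => i _; rewrite /cos_coeff' !normrM normfV !normrX normrN1.
  rewrite expr1n mul1r [X in _ / X]ger0_norm// ler_wpM2r ?invr_ge0//.
  by rewrite lerXn2r ?nnegrE.
rewrite cospolyE; move: (series _ m) (series _ n) hm => p q.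
rewrite (distrC (cos t)) (distrC p q) => h1 h2.
have := ler_distD p q (cos t); lra.
Qed.

End CosineSeries.

(** * The cosine of a bounded operator *)

Section OperatorCosine.
Context {R : realType} {L : hilbert R}.
Variable T : L -> L.
Hypothesis bT : bounded_op setT T.
Implicit Types (x y : L) (d b e k m : R).

Let cT := @closed_subspace_setT R L.
Let sT := cT.1.
Let CP n x := opoly T (cpoly (cospoly n)) x.

Lemma iter_norm_le k n x : 0 <= k -> (forall x, hnorm (T x) <= k * hnorm x) ->
  hnorm (iter n T x) <= k ^+ n * hnorm x.
Proof.
move=> k0 hk; elim: n => [|n IH]; first by rewrite expr0 mul1r.
by rewrite iterS (le_trans (hk _))// exprS -mulrA ler_wpM2l.
Qed.

Lemma opoly_cospoly n x :
  CP n x = series (fun i => (ccoef i : R)%:C *: iter i.*2 T x) n.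
Proof.
rewrite /CP /cospoly seriesEord /=; elim: n => [|n IH].
  by rewrite !big_ord0 /cpoly rmorph0 -polyC0 opolyC scale0r.
rewrite !big_ord_recr /= /cpoly rmorphD /= opolyD -/(cpoly _) IH.
by rewrite map_polyZ map_polyXn opolyZXn.
Qed.

Lemma opcosE x :
  opcos T x = limn (series (fun i => (ccoef i : R)%:C *: iter i.*2 T x)).
Proof.
rewrite /opcos; congr (limn (series _)); apply/funext => i; congr (_ *: _).
by rewrite /ccoef rmorphM /= fmorphV rmorphXn /= rmorphN1 rmorph_nat.
Qed.

(** [opcos] is defined through [limn], which is informative only once convergence is known; the
    terms are dominated by [k^(2i) / (2i)! |x|]. *)
Lemma opcos_cvg x : CP ^~ x @ \oo --> opcos T x.
Proof.
have -> : CP ^~ x = series (fun i => (ccoef i : R)%:C *: iter i.*2 T x).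
  by apply/funext => n; rewrite opoly_cospoly.
set u := series _; suff [l ul] : exists l : L, u @ \oo --> l.
  by rewrite opcosE -/u (cvg_lim (@norm_hausdorff _ _) ul).
have [k k0 hk] := bounded_op_bound bT.
have hk' y : hnorm (T y) <= k * hnorm y by exact: hk.
apply: cauchy_hnorm_cvg => e e0.
have x1 : 0 < hnorm x + 1 by rewrite ltr_wpDl ?hnorm_ge0.
have [|N hN] := @even_exp_tail _ k (e / (hnorm x + 1)) (ltW k0).
  by rewrite divr_gt0.
exists N => n Nn; rewrite (sub_series_geq _ Nn).
rewrite (le_lt_trans (hnorm_sum _ _))//.
apply: (@le_lt_trans _ _ ((e / (hnorm x + 1)) * hnorm x)); last first.
  by rewrite mulrAC ltr_pdivrMr// ltr_pM2l// ltrDl.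
apply: le_trans (ler_wpM2r (hnorm_ge0 x) (hN N n (leqnn N) Nn)).
rewrite mulr_suml; apply: ler_sum => i _; rewrite hnormZ norm_ccoef.
rewrite mulrC mulrAC ler_wpM2r ?invr_ge0//.
exact: iter_norm_le (ltW k0) hk'.
Qed.

Lemma hnorm_lim_le (u : nat -> L) x k : u @ \oo --> x ->
  (forall e, 0 < e -> exists N, forall n, (N <= n)%N -> hnorm (u n) <= k + e) ->
  hnorm x <= k.
Proof.
move=> /cvg_hnormP ux h; apply/ler_addgt0Pl => e e0.
have e20 : 0 < e / 2 by rewrite divr_gt0.
have [N hN] := ux _ e20; have [M hM] := h _ e20.
have := hN _ (leq_maxl N M); have := hM _ (leq_maxr N M).
move: (maxn N M) => n; rewrite hnorm_sub => h1 h2.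
have := hnorm_triangle (x - u n) (u n); rewrite subrK; lra.
Qed.

Lemma opcos_lin (c : R[i]) x y :
  opcos T (c *: x + y) = c *: opcos T x + opcos T y.
Proof.
rewrite -(cvg_lim (@norm_hausdorff _ _) (@opcos_cvg (c *: x + y))).
apply: cvg_lim; first exact: norm_hausdorff.
have -> : CP ^~ (c *: x + y) = (fun n => c *: CP n x + CP n y).
  by apply/funext => n; have [_ + _] := opoly_op bT (cpoly (cospoly n)); apply.
apply: cvgD; last exact: opcos_cvg.
exact: cvgZl_tmp (@opcos_cvg x).
Qed.

Lemma opcos_rip : (forall x y, rip (T x) y = rip x (T y)) ->
  forall x y, rip (opcos T x) y = rip x (opcos T y).
Proof.
move=> sym x y; apply/eqP; rewrite -subr_eq0 -normr_le0.
apply: (@le_mulr_eps _ _ (hnorm x + hnorm y)) => [|e e0].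
  by rewrite addr_ge0 ?hnorm_ge0.
have /cvg_hnormP/(_ e e0)[N hN] := @opcos_cvg x.
have /cvg_hnormP/(_ e e0)[M hM] := @opcos_cvg y.
have := hN _ (leq_maxl N M); have := hM _ (leq_maxr N M).
move: (maxn N M) => n h1 h2.
have -> : rip (opcos T x) y - rip x (opcos T y)
    = rip x (CP n y - opcos T y) - rip (CP n x - opcos T x) y.
  by rewrite ripBl ripBr /CP opoly_real_rip//; ring.
rewrite (le_trans (ler_normB _ _))// mulrDr lerD//.
  by rewrite (le_trans (norm_rip_le _ _))// mulrC ler_wpM2r ?hnorm_ge0// ltW.
by rewrite (le_trans (norm_rip_le _ _))// ler_wpM2r ?hnorm_ge0// ltW.
Qed.

(** Operator form of the mean value bound [|t^n - m^n| <= n k^(n-1) |t - m|]. At [n = 0] the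
    truncated exponent is harmless because of the factor [n]. *)
Lemma iter_sub_le k m n x : 0 <= m <= k ->
  (forall x, hnorm (T x) <= k * hnorm x) ->
  hnorm (iter n T x - (m ^+ n)%:C *: x)
  <= n%:R * k ^+ n.-1 * hnorm (T x - m%:C *: x).
Proof.
move=> /andP[m0 mk] hk; have k0 := le_trans m0 mk.
elim: n => [|n IH]; first by rewrite scale1r subrr hnorm0 !mul0r.
have -> : iter n.+1 T x - (m ^+ n.+1)%:C *: x
    = iter n T (T x - m%:C *: x) + m%:C *: (iter n T x - (m ^+ n)%:C *: x).
  rewrite (bounded_opB sT (iter_op bT n))// (bounded_opZ _ sT (iter_op bT n))//.
  by rewrite -iterSr scalerBr addrA subrK scalerA -rmorphM exprS.
rewrite (le_trans (hnorm_triangle _ _))// hnormZ (ger0_norm m0).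
have -> : n.+1%:R * k ^+ n.+1.-1 * hnorm (T x - m%:C *: x)
    = k ^+ n * hnorm (T x - m%:C *: x)
      + n%:R * k ^+ n * hnorm (T x - m%:C *: x) by rewrite -natr1 /=; ring.
rewrite lerD ?iter_norm_le//.
rewrite (le_trans (ler_wpM2l m0 IH))// mulrA ler_wpM2r ?hnorm_ge0//.
case: n {IH} => [|n]; first by rewrite !mul0r mulr0.
rewrite mulrCA ler_wpM2l// exprS /= ler_wpM2r// exprn_ge0//.
Qed.

(** Approximate eigenvectors of [T] at [m] are approximate eigenvectors of [opcos T] at [cos m];
    only the finiteness of the factor matters. *)
Lemma opcos_sub_le k m x : 0 <= m <= k ->
  (forall x, hnorm (T x) <= k * hnorm x) ->
  hnorm (opcos T x - (cos m)%:C *: x) <= expR k * hnorm (T x - m%:C *: x).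
Proof.
move=> mk hk; have /andP[m0 lmk] := mk; have k0 := le_trans m0 lmk.
have hCP n : hnorm (CP n x - ((cospoly n).[m])%:C *: x)
    <= expR k * hnorm (T x - m%:C *: x).
  have -> : CP n x - ((cospoly n).[m])%:C *: x = \sum_(i < n)
      (ccoef i)%:C *: (iter i.*2 T x - (m ^+ i.*2)%:C *: x).
    rewrite opoly_cospoly seriesEord /= cospolyE seriesEord /= rmorph_sum scaler_suml.
    rewrite -sumrB; apply: eq_bigr => i _; rewrite scalerBr scalerA -rmorphM.
    by rewrite /= /ccoef /cos_coeff' mulrAC.
  rewrite (le_trans (hnorm_sum _ _))//.
  apply: (@le_trans _ _ (\sum_(i < n) (i.*2)`!%:R^-1 * ((i.*2)%:R * k ^+ (i.*2).-1)
       * hnorm (T x - m%:C *: x))).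
    apply: ler_sum => i _; rewrite hnormZ norm_ccoef -mulrA ler_wpM2l ?invr_ge0//.
    exact: iter_sub_le.
  rewrite -mulr_suml ler_wpM2r ?hnorm_ge0//.
  case: n => [|n]; first by rewrite big_ord0 expR_ge0.
  (* The term [i = 0] vanishes, and [2i / (2i)! = 1 / (2i - 1)!] leaves the odd terms of the
     exponential series. *)
  have -> : \sum_(i < n.+1) (i.*2)`!%:R^-1 * ((i.*2)%:R * k ^+ (i.*2).-1)
      = \sum_(i < n) exp_coeff k i.*2.+1.
    rewrite big_ord_recl /= mul0r mulr0 add0r; apply: eq_bigr => i _.
    rewrite /bump /= add1n doubleS /exp_coeff /= (factS i.*2.+1) natrM.
    have a0 : (i.*2.+2)%:R != 0 :> R by rewrite pnatr_eq0.
    by rewrite invfM mulrACA mulVf// mul1r mulrC.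
  rewrite (le_trans _ (series_exp_le n.*2 k0))//.
  elim: n => [|n IH]; first by rewrite big_ord0 seriesEnat /= big_geq.
  rewrite big_ord_recr doubleS !seriesSr -addrA lerD//= lerDr.
  exact: exp_coeff_ge0.
apply: (@hnorm_lim_le (fun n => CP n x - ((cospoly n).[m])%:C *: x
    + ((cospoly n).[m] - cos m)%:C *: x)).
  have -> : (fun n => CP n x - ((cospoly n).[m])%:C *: x
      + ((cospoly n).[m] - cos m)%:C *: x) = (fun n => CP n x - (cos m)%:C *: x).
    apply/funext => n; rewrite rmorphB scalerBl addrA subrK //.
  by apply: cvgB; [exact: opcos_cvg|exact: cvg_cst].
move=> e e0; have x1 : 0 < hnorm x + 1 by rewrite ltr_wpDl ?hnorm_ge0.
have [|N hN] := @cospoly_uniform _ m (e / (hnorm x + 1)) m0.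
  by rewrite divr_gt0.
exists N => n Nn; rewrite (le_trans (hnorm_triangle _ _))// lerD// hnormZ.
rewrite (le_trans (ler_wpM2r (hnorm_ge0 x) (hN n Nn m _)))// ?ger0_norm//.
by rewrite mulrAC ler_pdivrMr// ler_pM2l// lerDl.
Qed.

Section Bounds.
Hypothesis symT : forall x y, rip (T x) y = rip x (T y).
Hypotheses (realT : forall x, complex.Im (ip L (T x) x) = 0).
Variable d : R.
Hypotheses (d0 : 0 <= d) (dpi : d <= pi / 2).
Hypotheses (geT : forall x, d * hnorm x ^+ 2 <= rip (T x) x).
Hypotheses (leT : forall x, rip (T x) x <= (pi / 2) * hnorm x ^+ 2).

(** The cosine is nonnegative and decreasing on [[d, pi/2]], so its Taylor polynomials are
    eventually at most [cos d + e] there in absolute value; the polynomial bound passes to the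
    limit. *)
Lemma opcos_norm_le x : hnorm (opcos T x) <= cos d * hnorm x.
Proof.
apply: hnorm_lim_le (@opcos_cvg x) _ => e e0.
have x1 : 0 < hnorm x + 1 by rewrite ltr_wpDl ?hnorm_ge0.
have pi0 : 0 <= (pi : R) / 2 by exact: le_trans dpi.
have pile : (pi : R) / 2 <= pi by have := pi_gt0 R; lra.
have cos0 (t : R) : 0 <= t <= pi / 2 -> 0 <= cos t.
  by move=> /andP[t0 tpi]; have := le_cos t0 tpi pile; rewrite cos_pihalf.
have [|N hN] := @cospoly_uniform _ (pi / 2) (e / (hnorm x + 1)) pi0.
  by rewrite divr_gt0.
exists N => n Nn.
have : hnorm (CP n x) <= (cos d + e / (hnorm x + 1)) * hnorm x.
  apply: (opoly_norm_le bT symT realT geT leT).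
    by rewrite addr_ge0 ?cos0 ?d0// ltW// divr_gt0.
  move=> t /andP[dt tpi]; have t0 := le_trans d0 dt.
  have ht := hN n Nn t; rewrite ger0_norm// in ht; have := ht tpi.
  have ctd : cos t <= cos d.
    by rewrite le_cos// (le_trans tpi).
  have ct0 : 0 <= cos t by rewrite cos0// t0.
  move=> h; have := ler_distD (cos t) ((cospoly n).[t]) 0.
  rewrite !subr0 (ger0_norm ct0); lra.
move=> /le_trans-> //; rewrite mulrDl lerD2l.
by rewrite mulrAC ler_pdivrMr// ler_pM2l// lerDl.
Qed.

Lemma opcos_op : bounded_op setT (opcos T).
Proof.
split=> // [c x y _ _|]; first exact: opcos_lin.
by exists (cos d) => x _; exact: opcos_norm_le.
Qed.

End Bounds.

End OperatorCosine.

(** * The Halmos angle operator *)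

Section PositiveOperator.
Context {R : realType} {L : hilbert R}.
Implicit Types (x y : L) (S T : L -> L) (d e k m : R).

Let sT := (@closed_subspace_setT R L).1.

(** Polarization at [x + 'i *: y], whose form has imaginary part [rip (T y) x - rip (T x) y] besides
    two vanishing terms. *)
Lemma real_form_symmetric T : bounded_op setT T ->
  (forall x, complex.Im (ip L (T x) x) = 0) ->
  forall x y, rip (T x) y = rip x (T y).
Proof.
move=> bT rT x y; rewrite [RHS]ripC.
have := rT (x + 'i *: y).
rewrite (bounded_opD bT)// (bounded_opZ _ sT bT)//.
rewrite !linearDl /= !linearDr /= !linearZl_LR /= !linearZr_LR /= conjcE /rip.
have := rT x; have := rT y.
case: (ip L (T x) x) => a b; case: (ip L (T y) y) => c d.
case: (ip L (T x) y) => e f; case: (ip L (T y) x) => g h /= -> ->.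
lra.
Qed.

(** This is [S^2 <= k S], obtained from positivity of the form at [x - k^-1 S x]. *)
Lemma positive_sqr_le S k : bounded_op setT S ->
  (forall x y, rip (S x) y = rip x (S y)) -> (forall x, 0 <= rip (S x) x) ->
  0 < k -> (forall x, hnorm (S x) <= k * hnorm x) ->
  forall x, hnorm (S x) ^+ 2 <= k * rip (S x) x.
Proof.
move=> bS sym pos k0 hk x.
have := pos (x - (k^-1)%:C *: S x).
rewrite (bounded_opB sT bS)// (bounded_opZ _ sT bS)// !(ripBl, ripBr, ripZl, ripZr).
rewrite (sym (S x) x) ripxx.
have h : rip (S (S x)) (S x) <= k * hnorm (S x) ^+ 2.
  by rewrite (le_trans (rip_le _ _))// expr2 mulrA ler_wpM2r ?hnorm_ge0.
have h2 : k^-1 * (k^-1 * rip (S (S x)) (S x)) <= k^-1 * hnorm (S x) ^+ 2.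
  by rewrite ler_pM2l ?invr_gt0// ler_pdivrMl.
move=> h3; rewrite -ler_pdivrMl//; lra.
Qed.

Lemma symmetric_opnorm_sqr S : bounded_op setT S ->
  (forall x y, rip (S x) y = rip x (S y)) ->
  opnorm setT (S \o S) = opnorm setT S ^+ 2.
Proof.
move=> bS sym; have bSS := bounded_op_comp bS bS.
have n0 := opnorm_ge0 setT S.
apply/eqP; rewrite eq_le; apply/andP; split.
  apply: opnorm_le => // [|x _]; first exact: sqr_ge0.
  rewrite (le_trans (opnorm_bound sT bS I))// expr2 -mulrA ler_wpM2l//.
  exact: opnorm_bound.
have : opnorm setT S <= Num.sqrt (opnorm setT (S \o S)).
  apply: opnorm_le => // x _.
  rewrite ler_sqr_hnorm ?mulr_ge0 ?hnorm_ge0 ?sqrtr_ge0// exprMn.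
  rewrite sqr_sqrtr ?opnorm_ge0// -ripxx -sym (le_trans (rip_le _ _))//.
  by rewrite expr2 mulrA ler_wpM2r ?hnorm_ge0//; exact: (opnorm_bound sT bSS I).
rewrite -ler_sqr ?nnegrE ?sqrtr_ge0// => /le_trans-> //.
by rewrite sqr_sqrtr ?opnorm_ge0.
Qed.

Variable T : L -> L.
Hypothesis bT : bounded_op setT T.
Hypothesis realT : forall x, complex.Im (ip L (T x) x) = 0.
Hypothesis ge0T : forall x, 0 <= rip (T x) x.

Lemma min_form : (exists x : L, x != 0) -> exists m,
  [/\ 0 <= m, forall x, m * hnorm x ^+ 2 <= rip (T x) x
    & forall e, 0 < e -> exists2 x, hnorm x = 1 & hnorm (T x - m%:C *: x) < e].
Proof.
move=> [x0 nx0]; pose D := [set rip (T x) x | x in [set x | hnorm x = 1]].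
have unit x : x != 0 -> hnorm ((hnorm x)^-1%:C *: x) = 1.
  by rewrite -hnorm_gt0 => p; rewrite hnormZ gtr0_norm ?invr_gt0// mulVf// gt_eqF.
have hD : has_inf D.
  split; last by exists 0 => _ [x _ <-].
  pose y := (hnorm x0)^-1%:C *: x0.
  by exists (rip (T y) y), y => //=; exact: unit.
pose m := inf D.
have m0 : 0 <= m by apply: lb_le_inf; [case: hD|move=> _ [x _ <-]].
have lem x : m * hnorm x ^+ 2 <= rip (T x) x.
  have [->|nx] := eqVneq x 0.
    by rewrite hnorm0 expr0n mulr0 rip0r.
  have p : 0 < hnorm x ^+ 2 by rewrite exprn_gt0// hnorm_gt0.
  rewrite -ler_pdivlMr//.
  have -> : rip (T x) x / hnorm x ^+ 2
      = rip (T ((hnorm x)^-1%:C *: x)) ((hnorm x)^-1%:C *: x).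
    by rewrite (bounded_opZ _ sT bT)// ripZl ripZr expr2 invfM; ring.
  by apply: ge_inf; [case: hD|exists ((hnorm x)^-1%:C *: x) => //=; exact: unit].
exists m; split=> // e e0.
pose S x := T x - m%:C *: x.
have bS : bounded_op setT S.
  have := bounded_op_lin (- m%:C) sT (bounded_op_id sT) bT.
  by apply: bounded_op_ext => // x _; rewrite scaleNr addrC.
have symT := real_form_symmetric bT realT.
have [k k0 hk] := bounded_op_bound bS.
have hS := @positive_sqr_le S k bS _ _ k0 (fun x => hk x I).
have [|_ [x x1 <-] hx] := @inf_adherent _ D (e ^+ 2 / k) _ hD.
  by rewrite divr_gt0// exprn_gt0.
exists x => //; rewrite -ltr_sqr ?nnegrE ?hnorm_ge0 ?(ltW e0)//.
rewrite (le_lt_trans (hS _ _ x))//.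
- by move=> y z; rewrite /S !(ripBl, ripBr, ripZl, ripZr) symT.
- by move=> y; rewrite /S ripBl ripZl ripxx subr_ge0.
by rewrite /S ripBl ripZl ripxx x1 expr1n mulr1 -ltr_pdivlMl// mulrC ltrBlDl.
Qed.

Lemma approx_not_invertible m :
  (forall e, 0 < e -> exists2 x, hnorm x = 1 & hnorm (T x - m%:C *: x) < e) ->
  spectrum T m%:C.
Proof.
move=> h [G /inverse_op_below[d d0 hd]].
have [x x1] := h d d0; have := hd x; rewrite x1 mulr1 => /le_lt_trans/[apply].
by rewrite ltxx.
Qed.

Lemma coercive_invertible m : 0 < m ->
  (forall x, m * hnorm x ^+ 2 <= rip (T x) x) -> invertible_op T.
Proof.
move=> m0 h; apply: (lax_milgram bT m0) => x.
by rewrite (le_trans (h x))// (le_trans (ler_norm _))// rip_le_norm_ip.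
Qed.

End PositiveOperator.

(** * The cosine and the inverse of the angle operator *)

Section HalmosAngle.
Context {R : realType} {L : hilbert R}.
Variable T : L -> L.
Hypothesis bT : bounded_op setT T.
Hypothesis ge0T : forall x, 0 <= ip L (T x) x.
Hypothesis leT : forall x, ip L (T x) x <= (pi / 2)%:C * ip L x x.
Implicit Types (x y : L) (d e k m : R).

Let sT := (@closed_subspace_setT R L).1.

Lemma angle_op_real x : complex.Im (ip L (T x) x) = 0.
Proof. exact: ger0_Im. Qed.

Lemma angle_op_ge0 x : 0 <= rip (T x) x.
Proof. by have := ge0T x; rewrite lecE => /andP[]. Qed.

Lemma angle_op_le x : rip (T x) x <= pi / 2 * hnorm x ^+ 2.
Proof. by have := leT x; rewrite lecE ipxx ReZ => /andP[]. Qed.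

Lemma angle_op_rip x y : rip (T x) y = rip x (T y).
Proof. exact: (real_form_symmetric bT angle_op_real). Qed.

Lemma pihalf_ge0 : 0 <= (pi : R) / 2.
Proof. by rewrite divr_ge0// pi_ge0. Qed.

Lemma angle_cos_op : bounded_op setT (opcos T).
Proof.
apply: (opcos_op bT angle_op_rip angle_op_real (lexx 0) pihalf_ge0).
  by move=> x; rewrite mul0r angle_op_ge0.
exact: angle_op_le.
Qed.

Lemma angle_cos_rip x y : rip (opcos T x) y = rip x (opcos T y).
Proof. exact: opcos_rip bT angle_op_rip x y. Qed.

Variable m : R.
Hypothesis m0 : 0 <= m.
Hypothesis lem : forall x, m * hnorm x ^+ 2 <= rip (T x) x.
Hypothesis approx :
  forall e, 0 < e -> exists2 x, hnorm x = 1 & hnorm (T x - m%:C *: x) < e.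

Lemma min_form_pihalf : m <= pi / 2.
Proof.
have [x x1 _] := approx ltr01.
by have := le_trans (lem x) (angle_op_le x); rewrite x1 expr1n !mulr1.
Qed.

Lemma opcos_approx e : 0 < e ->
  exists2 x, hnorm x = 1 & hnorm (opcos T x - (cos m)%:C *: x) < e.
Proof.
move=> e0; have [k k0 hk] := bounded_op_bound bT.
have mk : 0 <= m <= k + m by rewrite m0 lerDr ltW.
have hk' x : hnorm (T x) <= (k + m) * hnorm x.
  by rewrite (le_trans (hk x I))// ler_wpM2r ?hnorm_ge0// lerDl.
have [|x x1 hx] := approx (e := e / expR (k + m)).
  by rewrite divr_gt0 ?expR_gt0.
exists x => //; rewrite (le_lt_trans (opcos_sub_le bT x mk hk'))//.
by rewrite mulrC -ltr_pdivlMr ?expR_gt0.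
Qed.

Lemma opcos_opnorm : opnorm setT (opcos T) = cos m.
Proof.
have mpi := min_form_pihalf.
have cosm0 : 0 <= cos m.
  by rewrite -(@cos_pihalf R) le_cos//; have := pi_gt0 R; lra.
apply/eqP; rewrite eq_le; apply/andP; split.
  apply: opnorm_le => // x _.
  exact: (opcos_norm_le bT angle_op_rip angle_op_real m0 mpi lem angle_op_le).
apply/ler_addgt0Pl => e e0; have [x x1 hx] := opcos_approx e0.
have := opnorm_bound sT angle_cos_op (I : setT x); rewrite x1 mulr1 => h.
have : hnorm ((cos m)%:C *: x) = cos m by rewrite hnormZ x1 mulr1 ger0_norm.
have := hnorm_triangle_sub (opcos T x) ((cos m)%:C *: x) 0.
rewrite !subr0 (hnorm_sub _ (opcos T x)); lra.
Qed.

Lemma angle_op_invertible : invertible_op T <-> 0 < m.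
Proof.
split=> [[G /inverse_op_below[d d0 hd]]|mp]; last exact: coercive_invertible lem.
have [|x x1 hx] := approx (e := d); first by [].
have := hd x; rewrite x1 mulr1 => dx.
have := hnorm_triangle (T x - m%:C *: x) (m%:C *: x).
rewrite subrK hnormZ x1 mulr1 ger0_norm//; lra.
Qed.

Lemma angle_inverse_opnorm G : inverse_op T G -> (opnorm setT G)^-1 = m.
Proof.
move=> TG; have [bG GT TGx] := TG.
have mp : 0 < m by apply/angle_op_invertible; exists G.
suff -> : opnorm setT G = m^-1 by rewrite invrK.
apply/eqP; rewrite eq_le; apply/andP; split.
  apply: opnorm_le => // [|x _]; first by rewrite invr_ge0.
  rewrite ler_pdivlMl//; have [->|nz] := eqVneq (G x) 0.
    by rewrite hnorm0 mulr0 hnorm_ge0.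
  have p : 0 < hnorm (G x) by rewrite hnorm_gt0.
  rewrite -(ler_pM2r p) -mulrA -expr2 (le_trans (lem _))// TGx.
  exact: rip_le.
(* For a unit [x] with [T x] close to [m x], [1 = |G (T x)| <= |G| (m + e)]. *)
rewrite -[_^-1]mul1r ler_pdivrMr// -subr_le0.
apply: (@le_mulr_eps _ _ (opnorm setT G)) => [|e e0]; first exact: opnorm_ge0.
have [x x1 hx] := approx e0.
have := opnorm_bound sT bG (I : setT (T x)); rewrite GT x1 => h.
have : hnorm (T x) <= m + e.
  have := hnorm_triangle (T x - m%:C *: x) (m%:C *: x).
  by rewrite subrK hnormZ x1 mulr1 ger0_norm//; lra.
move=> /(ler_wpM2l (opnorm_ge0 setT G)); lra.
Qed.

End HalmosAngle.

(** * Transfer of norms through the Halmos representation *)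

Section HalmosRepresentation.
Context {R : realType} {H L : hilbert R}.
Implicit Types (M : set H) (A P Q : H -> H) (U : H -> L * L) (T : L -> L).

(** [P Q P] is the product of [P Q] and its adjoint [Q P]; the lower bound is
    [|Q P x|^2 = <P Q P x, x>]. *)
Lemma pair_prod_opnorm_sqr M A P Q : lsubspace M -> diff_pairs M A (P, Q) ->
  opnorm M (P \o Q \o P) = opnorm M (P \o Q) ^+ 2.
Proof.
move=> sM PQ; have [/= oP oQ _] := PQ; have bPQ := pair_prod_op PQ.
have MP := orthoproj_mem oP; have MQ := orthoproj_mem oQ.
have c0 := opnorm_ge0 M (P \o Q).
apply/eqP; rewrite eq_le; apply/andP; split.
  apply: opnorm_le => // [|x Mx /=]; first exact: sqr_ge0.
  rewrite -(orthoprojK oQ (MP _ Mx)).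
  rewrite (le_trans (opnorm_bound sM bPQ (MQ _ (MP _ Mx))))// expr2 -mulrA.
  rewrite ler_wpM2l// (orthoproj_prodC_le oP oQ)// => y My.
  exact: (opnorm_bound sM bPQ My).
have bPQP := bounded_op_comp bPQ (orthoproj_op oP).
have : opnorm M (P \o Q) <= Num.sqrt (opnorm M (P \o Q \o P)).
  apply: opnorm_le => //.
  apply: (orthoproj_prodC_le oQ oP) => // x Mx.
  rewrite ler_sqr_hnorm ?mulr_ge0 ?hnorm_ge0 ?sqrtr_ge0// exprMn.
  rewrite sqr_sqrtr ?opnorm_ge0//= -(orthoproj_sqr oQ)//; last exact: MP.
  rewrite -(orthoproj_rip oP)//; last exact/MQ/MP.
  rewrite (le_trans (rip_le _ _))// expr2 mulrA ler_wpM2r ?hnorm_ge0//.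
  exact: (opnorm_bound sM bPQP Mx).
rewrite -ler_sqr ?nnegrE ?sqrtr_ge0// => /le_trans-> //.
by rewrite sqr_sqrtr ?opnorm_ge0.
Qed.

Lemma prod_norm0r (x : L) : prod_norm (x, 0) = hnorm x.
Proof.
by rewrite /prod_norm /= hnorm0 expr0n addr0 sqrtr_sqr ger0_norm ?hnorm_ge0.
Qed.

Lemma hnorm_le_prod_norm (z : L * L) : hnorm z.1 <= prod_norm z.
Proof.
rewrite -[leLHS]ger0_norm ?hnorm_ge0// -sqrtr_sqr ler_wsqrtr//.
by rewrite lerDl sqr_ge0.
Qed.

Lemma prod_opnorm_block (S : L -> L) :
  prod_opnorm (block_op S (@zero_op R L) (@zero_op R L) (@zero_op R L))
  = opnorm setT S.
Proof.
have blockE z : block_op S (@zero_op R L) (@zero_op R L) (@zero_op R L) z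
    = (S z.1, 0) by rewrite /block_op /zero_op !addr0.
rewrite /prod_opnorm /opnorm; congr sup; apply/seteqP; split=> _ [z z1 <-].
  exists z.1; last by rewrite blockE prod_norm0r.
  by split=> //; exact: le_trans (hnorm_le_prod_norm z) z1.
exists (z, 0); last by rewrite blockE prod_norm0r.
by rewrite /= prod_norm0r; case: z1.
Qed.

(** In [P Q P] the outer [P] discards the lower row of [Q] and the inner one feeds 0 to its second
    column, so the sine survives only at 0. *)
Lemma opsin0 T : T 0 = 0 -> opsin T 0 = 0.
Proof.
move=> T0; rewrite /opsin; set u := series _.
have -> : u = fun=> 0.
  apply/funext => n; rewrite /u seriesEnat /= big1// => i _.
  have -> : iter i.*2 T 0 = 0 by elim: (i.*2) => //= j ->.
  by rewrite T0 scaler0.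
by apply: cvg_lim; [exact: norm_hausdorff|exact: cvg_cst].
Qed.

Section Representation.
Variables (M : set H) (A P Q : H -> H) (U : H -> L * L) (T : L -> L).
Hypotheses (sM : lsubspace M) (PQ : diff_pairs M A (P, Q)).
Hypothesis hU : halmos_rep M P Q U T.

Lemma halmos_prod x : M x -> U (P (Q (P x))) = (opcos T (opcos T (U x).1), 0).
Proof.
have [/= oP oQ _] := PQ; move=> Mx.
have bT := halmos_op hU; have bC := angle_cos_op bT (halmos_ge0 hU) (halmos_le hU).
have sT := (@closed_subspace_setT R L).1.
have MPx := orthoproj_mem oP Mx; have MQPx := orthoproj_mem oQ MPx.
rewrite (halmos_P hU)// (halmos_Q hU)// (halmos_P hU)//.
rewrite /block_op /zero_op /= !addr0 (opsin0 (bounded_op0 sT bT)).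
by rewrite (bounded_op0 sT bC) addr0.
Qed.

Lemma halmos_opnorm : opnorm M (P \o Q \o P) = opnorm setT (opcos T \o opcos T).
Proof.
have [/= oP oQ _] := PQ.
have [[Ufun _ Usurj] _ Uiso] := halmos_iso hU.
rewrite -prod_opnorm_block /prod_opnorm /opnorm; congr sup; apply/seteqP.
have key x : M x -> hnorm (P (Q (P x))) = prod_norm (block_op
    (opcos T \o opcos T) (@zero_op R L) (@zero_op R L) (@zero_op R L) (U x)).
  move=> Mx; rewrite -Uiso; last first.
    exact/(orthoproj_mem oP)/(orthoproj_mem oQ)/(orthoproj_mem oP).
  by rewrite halmos_prod// /block_op /zero_op /= !addr0.
split=> r [x].
  by move=> [Mx x1] <-; exists (U x); rewrite /= ?key// Uiso.
move=> x1 <-; have [y My yx] := Usurj x I.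
by exists y; rewrite /= ?key ?yx//; split=> //; rewrite -Uiso// yx.
Qed.

End Representation.

End HalmosRepresentation.

Theorem mainTheorem11 (R : realType) (H : hilbert R) (A : H -> H)
    (hA : proj_diffs A) (P Q : H -> H) (hPQ : diff_pairs setT A (P, Q)) :
  [/\ friedrichs_cos (range P) (range Q) = opnorm (generic_space A) (P \o Q),
      forall (L : hilbert R) (U : H -> L * L) (Gamma : L -> L),
        halmos_rep (generic_space A) P Q U Gamma ->
        [/\ [/\ opnorm (generic_space A) (P \o Q)
                  = Num.sqrt (opnorm (generic_space A) (P \o Q \o P)),
                Num.sqrt (opnorm (generic_space A) (P \o Q \o P))
                  = Num.sqrt (prod_opnorm
                      (block_op (opcos Gamma \o opcos Gamma)
                         (@zero_op R L) (@zero_op R L) (@zero_op R L)))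
              & Num.sqrt (prod_opnorm
                  (block_op (opcos Gamma \o opcos Gamma)
                     (@zero_op R L) (@zero_op R L) (@zero_op R L)))
                  = opnorm setT (opcos Gamma)],
            friedrichs_angle (range P) (range Q)
              = acos (opnorm setT (opcos Gamma)),
            ~ invertible_op Gamma ->
              [/\ spectrum Gamma 0, spectrum (opcos Gamma) 1
                & friedrichs_angle (range P) (range Q) = 0],
            invertible_op Gamma <-> closed (range A)
          & forall G : L -> L, inverse_op Gamma G ->
              (exists x : L, x != 0) ->
              [/\ opnorm setT (opcos Gamma) = cos ((opnorm setT G)^-1),
                  friedrichs_angle (range P) (range Q) = (opnorm setT G)^-1,
                  spectrum Gamma (friedrichs_angle (range P) (range Q))%:C
                & forall l, spectrum Gamma l ->
                    (friedrichs_angle (range P) (range Q))%:C <= l]],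
      forall P' Q' : H -> H, diff_pairs setT A (P', Q') ->
        friedrichs_angle (range P') (range Q')
          = friedrichs_angle (range P) (range Q)
    & forall P1 Q1 P2 Q2 : H -> H,
        diff_pairs (generic_space A) A (P1, Q1) ->
        diff_pairs (generic_space A) A (P2, Q2) ->
        opnorm (generic_space A) (fun x => P1 x + Q1 x)
          = opnorm (generic_space A) (fun x => P2 x + Q2 x)].
Proof.
have cG := generic_space_closed A; have gPQ := generic_space_pair hPQ.
split.
- exact: friedrichs_cos_generic hPQ.
- move=> L U T hU; have bT := halmos_op hU.
  have ge0T := halmos_ge0 hU; have leT := halmos_le hU.
  have realT := angle_op_real ge0T; have geT := angle_op_ge0 ge0T.
  have bC := angle_cos_op bT ge0T leT; have symC := angle_cos_rip bT ge0T.
  have n0 := opnorm_ge0 (generic_space A) (P \o Q).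
  have nCC : opnorm (generic_space A) (P \o Q \o P) = opnorm setT (opcos T) ^+ 2.
    by rewrite (halmos_opnorm gPQ hU) symmetric_opnorm_sqr.
  have nC : opnorm (generic_space A) (P \o Q) = opnorm setT (opcos T).
    apply/eqP; rewrite -(@eqrXn2 _ 2) ?opnorm_ge0// -nCC.
    by rewrite (pair_prod_opnorm_sqr cG.1 gPQ).
  have angleE : friedrichs_angle (range P) (range Q) = acos (opnorm setT (opcos T)).
    by rewrite /friedrichs_angle (friedrichs_cos_generic hPQ) nC.
  (* On the zero space every bounded operator is invertible; so a non-invertible [T] comes with a
     nonzero vector, and [min_form] applies. *)
  have trivial_inv : ~ (exists x : L, x != 0) -> invertible_op T.
    move=> triv; apply: (lax_milgram bT ltr01) => x.
    have -> : x = 0 by apply: contrapT => /eqP nx; apply: triv; exists x.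
    by rewrite hnorm0 expr0n mulr0 Re_normc_ge0.
  (* The norm of [opcos T] is [cos m], and [acos] inverts [cos] because [m] lies in [[0, pi/2]]. *)
  have angle_min m : 0 <= m -> (forall x, m * hnorm x ^+ 2 <= rip (T x) x) ->
      (forall e, 0 < e -> exists2 x, hnorm x = 1 & hnorm (T x - m%:C *: x) < e) ->
      friedrichs_angle (range P) (range Q) = m.
    move=> m0 lem approx; rewrite angleE (opcos_opnorm bT ge0T leT m0 lem approx).
    rewrite cosK// in_itv /= m0 (le_trans (min_form_pihalf leT lem approx))//.
    by have := pi_gt0 R; lra.
  split.
  + split.
    * by rewrite nCC sqrtr_sqr ger0_norm ?opnorm_ge0.
    * by rewrite prod_opnorm_block (halmos_opnorm gPQ hU).
    * rewrite prod_opnorm_block symmetric_opnorm_sqr// sqrtr_sqr.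
      by rewrite ger0_norm ?opnorm_ge0.
  + exact: angleE.
  + move=> ninv; have nt : exists x : L, x != 0 by apply: contrapT => /trivial_inv.
    have [m [m0 lem approx]] := min_form bT realT geT nt.
    have inv := angle_op_invertible bT m0 lem approx.
    have mE : m = 0.
      apply/eqP; rewrite eq_le m0 andbT leNgt; apply/negP => /inv; exact: ninv.
    have h := approx_not_invertible approx.
    have hC := @approx_not_invertible _ _ (opcos T) (cos m)
      (opcos_approx bT m0 approx).
    split; [by rewrite mE in h|by rewrite mE cos0 in hC|].
    by rewrite (angle_min m m0 lem approx).
  + rewrite (closed_range_norm hPQ) nC.
    (* On the zero space both sides hold: [T] is invertible and the norm of the cosine is 0. *)
    have [nt|triv] := pselect (exists x : L, x != 0); last first.
      split=> _; last exact: trivial_inv.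
      rewrite (le_lt_trans _ ltr01)//; apply: opnorm_le => // x _.
      have -> : x = 0 by apply: contrapT => /eqP nx; apply: triv; exists x.
      by rewrite (bounded_op0 (@closed_subspace_setT R L).1 bC) hnorm0 mulr0.
    have [m [m0 lem approx]] := min_form bT realT geT nt.
    rewrite (angle_op_invertible bT m0 lem approx).
    rewrite (opcos_opnorm bT ge0T leT m0 lem approx).
    have mpi := min_form_pihalf leT lem approx.
    split=> [mp|]; last first.
      rewrite [0 < m]lt_neqAle m0 andbT; apply: contraTN => /eqP <-.
      by rewrite cos0 ltxx.
    rewrite -(@cos0 R) ltr_cos//; rewrite in_itv /= ?lexx ?pi_ge0//.
    by rewrite m0 (le_trans mpi)//; have := pi_gt0 R; lra.
  (* On the zero space [|G|^-1] would be [0^-1 = 0], while the angle is [acos 0 = pi / 2]; the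
     nonzero vector excludes this. *)
  + move=> G TG nt; have [m [m0 lem approx]] := min_form bT realT geT nt.
    rewrite (angle_inverse_opnorm bT m0 lem approx TG).
    rewrite (angle_min m m0 lem approx); split=> //.
    * exact: opcos_opnorm.
    * exact: approx_not_invertible.
    * move=> l sl; rewrite lecE /=.
      have [-> /andP[ml _]] := spectrum_bounds bT realT lem (angle_op_le leT) sl.
      by rewrite eqxx.
- move=> P' Q' hPQ'; rewrite /friedrichs_angle.
  by rewrite (friedrichs_cos_invariant hPQ hPQ').
- move=> P1 Q1 P2 Q2; apply: pair_sum_opnorm_invariant => //.
  + exact: generic_space_inj hPQ.
  + exact: generic_space_inj_sqr hPQ.
Qed.
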